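(* Let $\phi : (M^2 ,g) \to (N^n ,h)$ be a proper-biharmonic Riemannian immersion with mean curvature vector field $H$ and second fundamental form $B$, with $M^2$ oriented. Let $z$ be a complex coordinate on $M^2$. Then the function $\langle B(\partial z,\partial z),H\rangle$ is holomorphic if and only if the norm of $H$ is constant.
   Context: All objects are smooth; $(M^2,g)$ is an oriented two-dimensional Riemannian manifold, regarded as a one-dimensional complex manifold, and $(N^n,h)$ is a Riemannian manifold. A complex coordinate is $z=x+iy$ with $(x,y)$ isothermal, $g=\lambda^2(dx^2+dy^2)$, and $\partial z=\frac12(\partial x-i\,\partial y)$. $B$ and $\langle\cdot,\cdot\rangle$ are extended complex bilinearly. The curvature convention is $R(X,Y)=[\nabla_X,\nabla_Y]-\nabla_{[X,Y]}$. For a smooth map $\phi$, $\tau(\phi)=\mathrm{trace}\,\nabla d\phi$ is the tension field, and $\phi$ is harmonic if $\tau(\phi)=0$. The map $\phi$ is biharmonic if $\mathrm{trace}(\nabla^\phi)^2\tau(\phi)-\mathrm{trace}\,R^N(d\phi(\cdot),\tau(\phi))d\phi(\cdot)=0$ (with $\nabla^\phi$ the pull-back connection on $\phi^{-1}TN$), and proper-biharmonic if it is biharmonic and not harmonic. A Riemannian immersion is an isometric immersion, and $H=\frac12\mathrm{trace}\,B$.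
   Formalization: Connectedness is added: the domain of z is connected (|H| constant there), or M is connected and complex coordinates cover M (|H| constant on M). Without it the claim fails, e.g. for the disjoint union of a small sphere of radius 1/√2 and an equator in S^3. *)

(* Defs.v *)
From mathcomp Require Export all_boot all_order all_algebra complex.
From mathcomp Require Export all_classical all_reals all_analysis.

Set Implicit Arguments.
Unset Strict Implicit.
Unset Printing Implicit Defensive.

Import Order.TTheory GRing.Theory Num.Theory numFieldNormedType.Exports.
Local Open Scope classical_set_scope.
Local Open Scope ring_scope.

(* Riemannian geometry is developed with tensors given by their components in
   charts. Tangent vectors of an n-manifold are row vectors 'rV[R]_n of
   components in the coordinate frame of a chart. *)

Section Smooth.
Context {R : realType} {m : nat} {W : normedModType R}.

Definition iter_derive (vs : seq 'rV[R]_m) (f : 'rV[R]_m -> W) :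
    'rV[R]_m -> W :=
  foldr (fun v (k : 'rV[R]_m -> W) => (fun u => 'D_v k u)) f vs.

(* C^oo on a (intended to be open) set: every iterated directional derivative
   is Frechet differentiable at every point of the set. *)
Definition smooth_on (U : set 'rV[R]_m) (f : 'rV[R]_m -> W) : Prop :=
  forall vs u, U u -> differentiable (iter_derive vs f) u.

Definition pderive (i : 'I_m) (f : 'rV[R]_m -> W) (u : 'rV[R]_m) : W :=
  'D_(delta_mx 0 i) f u.

End Smooth.

(* [cfun] and [cinv] are total functions; they are only meaningful on [cdom]
   and on [cim], respectively. *)
Record chart (R : realType) (n : nat) (T : Type) := Chart {
  cdom : set T;
  cfun :> T -> 'rV[R]_n;
  cinv : 'rV[R]_n -> T
}.

Section Charts.
Context {R : realType} {n : nat} {T : topologicalType}.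
Implicit Types c d : chart R n T.

Definition cim c : set 'rV[R]_n := c @` cdom c.

Definition is_chart c : Prop :=
  [/\ open (cdom c), open (cim c),
      forall p, cdom c p -> cinv c (c p) = p,
      {within cdom c, continuous c} &
      {within cim c, continuous (cinv c)}].

Definition transition c d : 'rV[R]_n -> 'rV[R]_n := fun u => d (cinv c u).

Definition compatible c d : Prop :=
  smooth_on (c @` (cdom c `&` cdom d)) (transition c d) /\
  smooth_on (d @` (cdom c `&` cdom d)) (transition d c).

End Charts.

(* The smooth structure is given by its maximal atlas. *)
Record smooth_manifold (R : realType) (n : nat) := SmoothManifold {
  carrier :> topologicalType;
  manifold_hausdorff : hausdorff_space carrier;
  manifold_second_countable : @second_countable carrier;
  atlas : set (chart R n carrier);
  atlas_chart : forall c, atlas c -> is_chart c;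
  atlas_cover : forall p, exists c, atlas c /\ cdom c p;
  atlas_compatible : forall c d, atlas c -> atlas d -> compatible c d;
  atlas_maximal : forall c, is_chart c ->
    (forall d, atlas d -> compatible c d) -> atlas c
}.

Definition chart_at (R : realType) (n : nat) (M : smooth_manifold R n) (p : M) :
  chart R n M := projT1 (cid (atlas_cover p)).

(* The Jacobian matrix of the library acts on row vectors:
   (jacobian f u) i j is the i-th partial derivative of the j-th component. *)
Record riemannian_metric (R : realType) (n : nat) (M : smooth_manifold R n) :=
  RiemannianMetric {
  metric_mx :> chart R n M -> 'rV[R]_n -> 'M[R]_n;
  metric_smooth : forall c, atlas c -> smooth_on (cim c) (metric_mx c);
  metric_sym : forall c u, atlas c -> cim c u ->
    (metric_mx c u)^T = metric_mx c u;
  metric_posdef : forall c u (v : 'rV[R]_n), atlas c -> cim c u -> v != 0 ->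
    0 < (v *m metric_mx c u *m v^T) 0 0;
  metric_tensor : forall c d p, atlas c -> atlas d -> cdom c p -> cdom d p ->
    let J := jacobian (transition c d) (c p) in
    metric_mx c (c p) = J *m metric_mx d (d p) *m J^T
}.

(* An orientation is the maximal coherently oriented subatlas of its
   positively oriented charts. *)
Record orientation (R : realType) (n : nat) (M : smooth_manifold R n) :=
  Orientation {
  positive : set (chart R n M);
  positive_atlas : forall c, positive c -> atlas c;
  positive_cover : forall p, exists c, positive c /\ cdom c p;
  positive_coherent : forall c d p, positive c -> positive d ->
    cdom c p -> cdom d p -> 0 < \det (jacobian (transition c d) (c p));
  positive_maximal : forall c, atlas c ->
    (forall d p, positive d -> cdom c p -> cdom d p ->
       0 < \det (jacobian (transition c d) (c p))) ->
    positive c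
}.

Section LeviCivita.
Context {R : realType}.

(* Gamma^k_{ij} of the Levi-Civita connection of the metric G. *)
Definition christoffel (n : nat) (G : 'rV[R]_n -> 'M[R]_n) (u : 'rV[R]_n)
    (k i j : 'I_n) : R :=
  2^-1 * \sum_(l < n) invmx (G u) k l *
    (pderive i G u j l + pderive j G u i l - pderive l G u i j).

Definition christoffel_form (n : nat) (G : 'rV[R]_n -> 'M[R]_n) (u : 'rV[R]_n)
    (X Y : 'rV[R]_n) : 'rV[R]_n :=
  \row_k \sum_(i < n) \sum_(j < n) christoffel G u k i j * X 0 i * Y 0 j.

(* Pull-back connection: the covariant derivative, in the direction of the
   i-th coordinate field, of a vector field V along f. With f := id this is
   the Levi-Civita connection of G itself. *)
Definition cov (m n : nat) (G : 'rV[R]_n -> 'M[R]_n)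
    (f : 'rV[R]_m -> 'rV[R]_n) (i : 'I_m) (V : 'rV[R]_m -> 'rV[R]_n)
    (u : 'rV[R]_m) : 'rV[R]_n :=
  pderive i V u + christoffel_form G (f u) (pderive i f u) (V u).

(* R(X,Y)Z = [nabla_X, nabla_Y] Z - nabla_[X,Y] Z, computed on coordinate
   fields (whose brackets vanish) and extended trilinearly. *)
Definition curvature (n : nat) (G : 'rV[R]_n -> 'M[R]_n) (y : 'rV[R]_n)
    (X Y Z : 'rV[R]_n) : 'rV[R]_n :=
  let nabla := cov G id in
  \sum_(i < n) \sum_(j < n) \sum_(k < n) (X 0 i * Y 0 j * Z 0 k) *:
    (nabla i (nabla j (fun=> delta_mx 0 k)) y
     - nabla j (nabla i (fun=> delta_mx 0 k)) y).

Definition metric_trace (m n : nat) (G : 'rV[R]_m -> 'M[R]_m) (u : 'rV[R]_m)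
    (T : 'I_m -> 'I_m -> 'rV[R]_n) : 'rV[R]_n :=
  \sum_(i < m) \sum_(j < m) invmx (G u) i j *: T i j.

End LeviCivita.

(* A map f between coordinate domains carrying metrics G (source) and
   K (target). *)
Section LocalMap.
Context {R : realType} {m n : nat}.
Variables (G : 'rV[R]_m -> 'M[R]_m) (K : 'rV[R]_n -> 'M[R]_n).
Variable f : 'rV[R]_m -> 'rV[R]_n.

(* (nabla df)(d_i, d_j) = nabla^f_{d_i} df(d_j) - df(nabla_{d_i} d_j). For an
   isometric immersion this is B(d_i, d_j), by the Gauss formula. *)
Definition second_ff (u : 'rV[R]_m) (i j : 'I_m) : 'rV[R]_n :=
  cov K f i (pderive j f) u
  - \sum_(k < m) christoffel G u k i j *: pderive k f u.

Definition tension (u : 'rV[R]_m) : 'rV[R]_n :=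
  metric_trace G u (second_ff u).

Definition rough_laplacian (V : 'rV[R]_m -> 'rV[R]_n) (u : 'rV[R]_m) :
    'rV[R]_n :=
  metric_trace G u (fun i j =>
    cov K f i (cov K f j V) u
    - \sum_(k < m) christoffel G u k i j *: cov K f k V u).

Definition bitension (u : 'rV[R]_m) : 'rV[R]_n :=
  rough_laplacian tension u
  - metric_trace G u (fun i j =>
      curvature K (f u) (pderive i f u) (tension u) (pderive j f u)).

End LocalMap.

Section MapsOfManifolds.
Context {R : realType} {m n : nat}.
Context {M : smooth_manifold R m} {N : smooth_manifold R n}.
Variables (g : riemannian_metric M) (h : riemannian_metric N).
Variable phi : M -> N.

Definition local_rep (c : chart R m M) (d : chart R n N) :
    'rV[R]_m -> 'rV[R]_n := fun u => d (phi (cinv c u)).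

Definition smooth_map : Prop :=
  continuous phi /\
  forall c d, atlas c -> atlas d ->
    smooth_on (c @` (cdom c `&` phi @^-1` cdom d)) (local_rep c d).

(* phi is an immersion and g is the pull-back of h *)
Definition riemannian_immersion : Prop :=
  smooth_map /\
  forall c d p, atlas c -> atlas d -> cdom c p -> cdom d (phi p) ->
    let J := jacobian (local_rep c d) (c p) in
    row_free J /\ J *m h d (d (phi p)) *m J^T = g c (c p).

Definition harmonic : Prop :=
  forall c d p, atlas c -> atlas d -> cdom c p -> cdom d (phi p) ->
    tension (g c) (h d) (local_rep c d) (c p) = 0.

Definition biharmonic : Prop :=
  forall c d p, atlas c -> atlas d -> cdom c p -> cdom d (phi p) ->
    bitension (g c) (h d) (local_rep c d) (c p) = 0.

Definition proper_biharmonic : Prop := biharmonic /\ ~ harmonic.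

End MapsOfManifolds.

Section Surfaces.
Context {R : realType} {n : nat}.
Context {M : smooth_manifold R 2} {N : smooth_manifold R n}.
Variables (g : riemannian_metric M) (o : orientation M).
Variables (h : riemannian_metric N) (phi : M -> N).

(* H = (1/2) trace B, by its components in the chart d *)
Definition mean_curvature (c : chart R 2 M) (d : chart R n N) (p : M) :
    'rV[R]_n :=
  2^-1 *: metric_trace (g c) (c p)
            (second_ff (g c) (h d) (local_rep phi c d) (c p)).

(* The point p selects charts around p and phi p in which |H|(p) is
   evaluated. *)
Definition norm_H (p : M) : R :=
  let c := chart_at p in
  let d := chart_at (phi p) in
  let H := mean_curvature c d p in
  Num.sqrt ((H *m h d (d (phi p)) *m H^T) 0 0).

Definition complex_coordinate (z : chart R 2 M) : Prop :=
  positive o z /\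
  forall u, cim z u -> exists lambda : R,
    0 < lambda /\ g z u = (lambda ^+ 2)%:M.

Definition zfun (z : chart R 2 M) (p : M) : R[i] :=
  Complex (z p 0 0) (z p 0 1).

Definition zinv (z : chart R 2 M) (w : R[i]) : M :=
  cinv z (\row_(i < 2) if i == 0 then complex.Re w else complex.Im w).

(* d/dz = (1/2) (d/dx - i d/dy) *)
Definition partial_z : 'rV[R[i]]_2 :=
  2^-1 *: (delta_mx 0 0 - 'i%C *: delta_mx 0 1).

Definition bilinC (B : 'I_2 -> 'I_2 -> 'rV[R]_n) (X Y : 'rV[R[i]]_2) :
    'rV[R[i]]_n :=
  \sum_(i < 2) \sum_(j < 2) (X 0 i * Y 0 j) *: map_mx (real_complex R) (B i j).

Definition innerC (K : 'M[R]_n) (V W : 'rV[R[i]]_n) : R[i] :=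
  (V *m map_mx (real_complex R) K *m W^T) 0 0.

(* < B(d/dz, d/dz), H > at a point p of the domain of z *)
Definition BzzH (z : chart R 2 M) (p : M) : R[i] :=
  let d := chart_at (phi p) in
  let B := second_ff (g z) (h d) (local_rep phi z d) (z p) in
  let H := mean_curvature z d p in
  innerC (h d (d (phi p)))
    (bilinC B partial_z partial_z) (map_mx (real_complex R) H).

(* F, defined on the domain of the complex coordinate z, is complex
   differentiable as a function of z. *)
Definition holomorphic_in (z : chart R 2 M) (F : M -> R[i]) : Prop :=
  forall p, cdom z p ->
    derivable ((fun w => F (zinv z w)) : R[i]^o -> R[i]^o) (zfun z p) 1.

Definition constant_on (U : set M) (F : M -> R) : Prop :=
  exists k : R, forall p, U p -> F p = k.

End Surfaces.

(* Main.v *)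
From HB Require Import structures.
Require Import Defs.
From mathcomp Require Import ring lra.

(** Let W = tau(phi) = 2 H, a vector field along phi that is normal to the
surface, and A(X, Y) = <W, nabla_X dphi(Y)>. Since W is normal, this is
<W, B(X, Y)>, a symmetric 2-tensor on the surface. In isothermal coordinates
with g = E (dx^2 + dy^2) its trace A_00 + A_11 is E |W|^2, and
8 <B(d/dz, d/dz), H> = A_00 - A_11 - 2 i A_01 carries its trace-free part.

The biharmonic equation paired with a tangent vector dphi(x) expresses the
divergence of A. Differentiating <W, dphi(x)> = 0 twice in a direction v
([tangential_hessian]) expresses <nabla_v nabla_v W, dphi(x)> by the
derivative of A(v, x) in the direction v, a derivative of nabla_v dphi(v), and
the curvature term <R(dphi(v), dphi(x)) dphi(v), W> that appears when two
covariant derivatives are exchanged. By the pair symmetry of the curvature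
([curv_pair_symmetry]) that term cancels the curvature term of the equation.
Summing over v = d/dx, d/dy, where nabla_v dphi(v) adds up to E W, leaves
[conformal_stress_divergence]:
  2 (d_0 A(0, x) + d_1 A(1, x)) = d_x (A_00 + A_11) - (E / 2) d_x |W|^2.
This is the conservation law of the stress-bienergy tensor. For x = d/dx and
x = d/dy it says that the two Cauchy-Riemann equations of
A_00 - A_11 - 2 i A_01 fail exactly by the two partial derivatives of |W|^2,
up to the nonzero factor E. Hence that function is holomorphic if and only if
|H|^2 has zero gradient, that is, if and only if |H| is locally constant; on a
connected set this means constant.

Both |H| and <B(d/dz, d/dz), H> are given by components in arbitrary charts,
so they have to be shown independent of them. The Koszul formula gives that
the second fundamental form of an isometric map is normal to its image
([sff_normal]). A transition map is an isometry between open sets of the same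
dimension, so its second fundamental form vanishes ([isometry_sff0]), and the
composition formula ([sff_comp]) turns this into the tensor law for changes of
charts of the source and of the target.

The calculus behind this consists of the product and chain rules for
matrix-valued maps, the symmetry of second derivatives ([derive_comm]) and the
closure of smooth functions under the operations in use ([smooth_exprP]). *)

Import Order.TTheory GRing.Theory Num.Theory numFieldNormedType.Exports.
Local Open Scope classical_set_scope.
Local Open Scope ring_scope.
Set Implicit Arguments.
Unset Strict Implicit.
Unset Printing Implicit Defensive.

(** * Calculus of matrix-valued maps *)

Section MatrixCalculus.
Context {R : realType} {V : normedModType R}.
Implicit Types (x v : V).

Lemma differentiable_near (W : normedModType R) (f g : V -> W) x :
  (\near x, f x = g x) -> differentiable f x -> differentiable g x.
Proof.
move=> fg df.
have dc : continuous ('d f x) by exact: diff_continuous.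
have eg : g \o shift x = cst (g x) + 'd f x +o_ 0 id.
  apply/eqaddoP => e e0.
  have /eqaddoP /(_ e e0) := diff_locally df.
  have : \forall h \near (0 : V), f (h + x) = g (h + x).
    have := fg; rewrite (near_shift 0) => H; apply: filterS H => h /=.
    by rewrite subr0.
  apply: filterS2 => h /= fgh.
  by rewrite !fctE /= fgh (nbhs_singleton fg).
by apply/diff_locallyP; rewrite (diff_unique dc eg).
Qed.

Lemma derive_chain (U W : normedModType R) (f : V -> U) (g : U -> W) x v :
  differentiable f x -> differentiable g (f x) ->
  'D_v (g \o f) x = 'D_('D_v f x) g (f x).
Proof.
move=> df dg; rewrite !deriveE//; last exact: differentiable_comp.
by rewrite diff_comp.
Qed.

Lemma derive_dirD (W : normedModType R) (f : V -> W) x v w :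
  differentiable f x -> 'D_(v + w) f x = ('D_v f x) + ('D_w f x).
Proof. by move=> df; rewrite !deriveE// linearD. Qed.

Lemma derive_dirZ (W : normedModType R) (f : V -> W) x a v :
  differentiable f x -> 'D_(a *: v) f x = a *: ('D_v f x).
Proof. by move=> df; rewrite !deriveE// linearZ. Qed.

Lemma differentiable_mxP p q (M : V -> 'M[R]_(p, q)) x :
  differentiable M x <-> forall i j, differentiable (fun y => M y i j) x.
Proof.
split=> [dM i j|dM].
  apply: (@differentiable_comp _ _ _ _ M (fun N : 'M[R]_(p, q) => N i j)) => //.
  exact: differentiable_coord.
have -> : M = \sum_(i < p) \sum_(j < q) (fun y => M y i j *: delta_mx i j).
  apply/funext => y; rewrite [LHS]matrix_sum_delta fct_sumE.
  by apply: eq_bigr => i _; rewrite fct_sumE.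
apply: differentiable_sum => i; apply: differentiable_sum => j.
exact: differentiableZl.
Qed.

Lemma derive_coord p q (M : V -> 'M[R]_(p, q)) x v i j :
  differentiable M x -> ('D_v M x) i j = 'D_v (fun y => M y i j) x.
Proof. by move=> dM; rewrite derive_mx ?mxE//; exact: diff_derivable. Qed.

Lemma differentiable_bigsum (W : normedModType R) n (F : 'I_n -> V -> W) x :
  (forall i, differentiable (F i) x) ->
  differentiable (fun y => \sum_(i < n) F i y) x.
Proof.
move=> dF; rewrite (_ : (fun _ => _) = \sum_(i < n) F i).
  exact: differentiable_sum.
by apply/funext => y; rewrite fct_sumE.
Qed.

Lemma derive_bigsum (W : normedModType R) n (F : 'I_n -> V -> W) x v :
  (forall i, differentiable (F i) x) ->
  'D_v (fun y => \sum_(i < n) F i y) x = \sum_(i < n) 'D_v (F i) x.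
Proof.
move=> dF; rewrite -derive_sum; last by move=> i; exact: diff_derivable.
by congr ('D_v _ x); apply/funext => y; rewrite fct_sumE.
Qed.

Lemma differentiable_mulmx p q r (A : V -> 'M[R]_(p, q)) (B : V -> 'M[R]_(q, r)) x :
  differentiable A x -> differentiable B x ->
  differentiable (fun y => A y *m B y) x.
Proof.
move=> /differentiable_mxP dA /differentiable_mxP dB.
apply/differentiable_mxP => i j; under eq_fun do rewrite mxE.
by apply: differentiable_bigsum => k; exact: differentiableM.
Qed.

Lemma differentiable_entry p q (M : V -> 'M[R]_(p, q)) x i j :
  differentiable M x -> differentiable (fun y => M y i j) x.
Proof. by move=> /differentiable_mxP. Qed.

Lemma derive_mulmx p q r (A : V -> 'M[R]_(p, q)) (B : V -> 'M[R]_(q, r)) x v :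
  differentiable A x -> differentiable B x ->
  'D_v (fun y => A y *m B y) x = ('D_v A x) *m B x + A x *m ('D_v B x).
Proof.
move=> dA dB; apply/matrixP => i j.
have dAe k l : differentiable (fun y => A y k l) x by exact: differentiable_entry.
have dBe k l : differentiable (fun y => B y k l) x by exact: differentiable_entry.
rewrite derive_coord; last exact: differentiable_mulmx.
under eq_fun do rewrite mxE.
rewrite derive_bigsum; last by move=> k; exact: differentiableM.
rewrite !mxE -big_split /=; apply: eq_bigr => k _.
rewrite deriveM; [|exact: diff_derivable..].
by rewrite !derive_coord// addrC; congr (_ + _); rewrite mulrC.
Qed.

Lemma differentiable_trmx p q (A : V -> 'M[R]_(p, q)) x :
  differentiable A x -> differentiable (fun y => (A y)^T) x.
Proof.
move=> /differentiable_mxP dA; apply/differentiable_mxP => i j.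
by under eq_fun do rewrite mxE; exact: dA.
Qed.

Lemma derive_trmx p q (A : V -> 'M[R]_(p, q)) x v :
  differentiable A x -> 'D_v (fun y => (A y)^T) x = ('D_v A x)^T.
Proof.
move=> dA; apply/matrixP => i j; rewrite derive_coord; last first.
  exact: differentiable_trmx.
by under eq_fun do rewrite mxE; rewrite mxE derive_coord.
Qed.
End MatrixCalculus.

Section Schwarz.
Context {R : realType} {V : normedModType R}.

(** First-order expansion in the plane spanned by v and w, uniform in the first
coefficient s for |s| <= |t|: the point where the mean value theorem is applied
in [second_difference_expand] is only known to lie in that range. *)
Lemma diff_expand (g : V -> R) x v w e : differentiable g x -> 0 < e ->
  \forall t \near (0 : R), forall s : R, `|s| <= `|t| ->
    `|g (s *: v + t *: w + x) - g x - (s * 'D_v g x + t * 'D_w g x)| <= e * `|t|.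
Proof.
move=> dg e0.
have /eqaddoP := diff_locally dg.
have k0 : 0 < `|v| + `|w| + 1.
  by rewrite -addrA ltr_wpDl// ltr_wpDl.
move=> /(_ (e / (`|v| + `|w| + 1)) (divr_gt0 e0 k0)) /nbhs_ballP[d /= d0 dP].
apply/nbhs_ballP; exists (d / (`|v| + `|w| + 1)); first exact: divr_gt0.
move=> t; rewrite /ball /= sub0r normrN ltr_pdivlMr// => td s st.
have N : `|s *: v + t *: w| <= `|t| * (`|v| + `|w| + 1).
  apply: (le_trans (ler_normD _ _)); rewrite !normrZ.
  have := ler_wpM2r (normr_ge0 v) st; have := normr_ge0 t; lra.
have := dP (s *: v + t *: w).
rewrite -ball_normE /= sub0r normrN.
have L : `|s *: v + t *: w| < d by exact: le_lt_trans td.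
move=> /(_ L); rewrite !fctE /= opprD addrA linearD !linearZ /= -!deriveE//.
move=> /le_trans; apply.
by rewrite mulrAC ler_pdivrMr// -mulrA ler_pM2l.
Qed.

Lemma is_derive_line (W : normedModType R) (f : V -> W) (v y : V) (s : R) :
  differentiable f (s *: v + y) ->
  is_derive s 1 (fun r : R => f (r *: v + y)) ('D_v f (s *: v + y)).
Proof.
move=> df; have dl : is_diff s (fun r : R => r *: v + y) (fun r : R => r *: v).
  have -> : (fun r : R => r *: v + y) = ( *:%R^~ v) + cst y by apply/funext.
  by apply: is_diff_eq; rewrite addr0.
apply: DeriveDef; first by apply/diff_derivable/differentiable_comp.
rewrite (derive_chain (f := fun r : R => r *: v + y))//.
have [dl1 dl2] := dl; by rewrite [X in 'D_X f _]deriveE// dl2 scale1r.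
Qed.

(** Symmetric in v and w; divided by t^2 it approximates both mixed second
derivatives. *)
Definition second_difference (f : V -> R) x v w (t : R) :=
  f (t *: v + t *: w + x) - f (t *: v + x) - (f (t *: w + x) - f x).

(** The mean value theorem along v turns the second difference into t times a
difference of two values of the first derivative along v, and the
differentiability of that derivative at x alone evaluates them both. *)
Lemma second_difference_expand (f : V -> R) x v w e :
  (\forall y \near x, differentiable f y) -> differentiable ('D_v f) x -> 0 < e ->
  \forall t \near (0 : R), 0 < t ->
    `|second_difference f x v w t - t ^+ 2 * 'D_w ('D_v f) x| <= e * t ^+ 2.
Proof.
move=> df dDf e0.
have k0 : 0 < `|v| + `|w| + 1 by rewrite -addrA ltr_wpDl// ltr_wpDl.
have e2 : 0 < e / 2 by rewrite divr_gt0.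
have B : \forall t \near (0 : R), forall s s' : R, `|s| <= `|t| -> `|s'| <= `|t| ->
    differentiable f (s *: v + (s' *: w + x)).
  move: df => /nbhs_ballP[d /= d0 dP].
  apply/nbhs_ballP; exists (d / (`|v| + `|w| + 1)); first exact: divr_gt0.
  move=> t; rewrite /ball /= sub0r normrN ltr_pdivlMr// => td s s' st s't.
  apply: dP; rewrite -ball_normE /= addrA distrC addrK.
  apply: le_lt_trans td; apply: (le_trans (ler_normD _ _)); rewrite !normrZ.
  have := ler_wpM2r (normr_ge0 v) st; have := ler_wpM2r (normr_ge0 w) s't.
  by have := normr_ge0 t; lra.
have := diff_expand v w dDf e2; have := diff_expand v 0 dDf e2.
move: B; apply: filterS3 => t B E0 Ew t0.
have tt : `|t| <= `|t| by [].
have zt : `|0 : R| <= `|t| by rewrite normr0.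
pose g (s : R) := f (s *: v + (t *: w + x)) - f (s *: v + x).
have dg (s : R) : `|s| <= `|t| -> is_derive s 1 g
    ('D_v f (s *: v + (t *: w + x)) - 'D_v f (s *: v + x)).
  move=> st; apply: is_deriveB; apply: is_derive_line; first exact: B.
  by have := B s 0 st zt; rewrite scale0r add0r.
have in0t (s : R) : s \in `[0, t]%R -> `|s| <= `|t|.
  by rewrite in_itv /= => /andP[s0 st]; rewrite !ger0_norm// (le_trans s0).
have [||c ct] := @MVT R g
    (fun s => 'D_v f (s *: v + (t *: w + x)) - 'D_v f (s *: v + x)) 0 t t0.
- by move=> s st; apply: dg; apply: in0t; exact: subset_itv_oo_cc.
- apply: derivable_within_continuous => s st.
  by have [] := dg s (in0t s st).
have {}ct := in0t _ (subset_itv_oo_cc ct).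
rewrite /g !scale0r !add0r subr0 addrA /second_difference => ->.
have := E0 _ ct; have := Ew _ ct.
rewrite scaler0 addr0 derive0 mulr0 addr0 (gtr0_norm t0) -!addrA.
set a := 'D_v f (_ + (_ + x)); set b := 'D_v f (_ + x); set z := 'D_v f x.
set y := 'D_v _ x; set q := 'D_w _ x => H1 H2.
have -> : (a - b) * t - t ^+ 2 * q = t * ((a - z - (c * y + t * q)) - (b - z - c * y)).
  by ring.
rewrite normrM (gtr0_norm t0).
have -> : e * t ^+ 2 = t * (e / 2 * t + e / 2 * t) by field.
by rewrite ler_pM2l//; apply: le_trans (ler_normB _ _) _; apply: lerD; rewrite -?addrA.
Qed.

(** Symmetry of second derivatives, without continuity of the second derivatives:
the second difference is symmetric in the two directions. *)
Lemma derive_comm (f : V -> R) x v w :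
  (\forall y \near x, differentiable f y) ->
  differentiable ('D_v f) x -> differentiable ('D_w f) x ->
  'D_v ('D_w f) x = 'D_w ('D_v f) x.
Proof.
move=> df dv dw.
apply/eqP; rewrite -subr_eq0 -normr_le0; apply/ler_addgt0Pl => e e0; rewrite addr0.
have e2 : 0 < e / 2 by rewrite divr_gt0.
have : \forall t \near (0 : R)^'+,
    `|t ^+ 2 * 'D_v ('D_w f) x - t ^+ 2 * 'D_w ('D_v f) x| <= e * t ^+ 2.
  have := second_difference_expand w df dv e2.
  have := second_difference_expand v df dw e2.
  apply: filterS2 => t H1 H2 t0.
  have {}H1 := H1 t0; have {}H2 := H2 t0.
  have E : second_difference f x w v t = second_difference f x v w t.
    rewrite /second_difference [t *: w + t *: v]addrC.
    move: (f (_ + _ + _)) (f (t *: w + x)) (f (t *: v + x)) (f x) => a b c d.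
    by ring.
  rewrite E in H1.
  move: H1 H2; set a := second_difference _ _ _ _ _.
  set A := 'D_v ('D_w f) x; set B := 'D_w ('D_v f) x => H1 H2.
  rewrite (_ : t ^+ 2 * A - t ^+ 2 * B = (a - t ^+ 2 * B) - (a - t ^+ 2 * A)); last by ring.
  rewrite (_ : e * _ = e / 2 * t ^+ 2 + e / 2 * t ^+ 2); last by field.
  exact: le_trans (ler_normB _ _) (lerD H2 H1).
move=> /filterI /(_ (nbhs_right_gt (0 : R))) /filter_ex[t [/= + t0]].
have t2 : 0 < t ^+ 2 by rewrite exprn_gt0.
by rewrite -mulrBr normrM (gtr0_norm t2) [e * _]mulrC ler_pM2l.
Qed.
End Schwarz.

(** * Closure properties of smooth functions *)

Section SmoothClosure.
Context {R : realType}.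

Lemma derive_partials m (W : normedModType R) (f : 'rV[R]_m -> W) u v :
  differentiable f u ->
  'D_v f u = \sum_(i < m) v 0 i *: pderive i f u.
Proof.
move=> df; rewrite {1}(row_sum_delta v) deriveE// linear_sum.
by apply: eq_bigr => i _; rewrite linearZ /= /pderive deriveE.
Qed.

Lemma smooth_on_differentiable m (W : normedModType R) (U : set 'rV[R]_m)
    (f : 'rV[R]_m -> W) u : smooth_on U f -> U u -> differentiable f u.
Proof. by move=> /(_ [::]); apply. Qed.

Lemma smooth_on_derive m (W : normedModType R) (U : set 'rV[R]_m)
    (f : 'rV[R]_m -> W) v : smooth_on U f -> smooth_on U ('D_v f).
Proof.
move=> sf vs u Uu; have := sf (rcons vs v) u Uu.
by rewrite /iter_derive foldr_rcons.
Qed.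

Lemma iter_derive_ext m (W : normedModType R) (U : set 'rV[R]_m)
    (f g : 'rV[R]_m -> W) vs : open U -> (forall u, U u -> f u = g u) ->
  forall u, U u -> iter_derive vs f u = iter_derive vs g u.
Proof.
move=> oU fg; elim: vs => //= v vs IH u Uu.
apply: near_eq_derive; have : nbhs u U by exact: open_nbhs_nbhs.
by apply: filterS => y Uy; apply: IH.
Qed.

Lemma smooth_on_ext m (W : normedModType R) (U : set 'rV[R]_m)
    (f g : 'rV[R]_m -> W) : open U -> (forall u, U u -> f u = g u) ->
  smooth_on U f -> smooth_on U g.
Proof.
move=> oU fg sf vs u Uu; apply: differentiable_near (sf vs u Uu).
have : nbhs u U by exact: open_nbhs_nbhs.
by apply: filterS => y Uy; apply: (iter_derive_ext vs oU fg).
Qed.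

Lemma smooth_on_subset m (W : normedModType R) (U U' : set 'rV[R]_m)
    (f : 'rV[R]_m -> W) : U' `<=` U -> smooth_on U f -> smooth_on U' f.
Proof. by move=> UU sf vs u /UU; exact: sf. Qed.

(** The functions obtained from smooth ones by the operations that occur in
Christoffel symbols and second fundamental forms. The directional derivatives
of such an expression are again such expressions, so that one induction on
expressions replaces an induction on the order of derivation for each
operation. *)
Inductive smooth_expr m (U : set 'rV[R]_m) : ('rV[R]_m -> R) -> Prop :=
| SmoothBase f : smooth_on U f -> smooth_expr U f
| SmoothCst (a : R) : smooth_expr U (fun=> a)
| SmoothAdd f g : smooth_expr U f -> smooth_expr U g ->
    smooth_expr U (fun u => f u + g u)
| SmoothMul f g : smooth_expr U f -> smooth_expr U g ->
    smooth_expr U (fun u => f u * g u)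
| SmoothInv f : smooth_expr U f -> (forall u, U u -> f u != 0) ->
    smooth_expr U (fun u => (f u)^-1)
| SmoothComp n (V : set 'rV[R]_n) (g : 'rV[R]_n -> R)
    (f : 'rV[R]_m -> 'rV[R]_n) :
    smooth_on V g -> (forall u, U u -> V (f u)) ->
    (forall j, smooth_expr U (fun u => f u 0 j)) ->
    smooth_expr U (g \o f)
| SmoothExt f g : (forall u, U u -> f u = g u) -> smooth_expr U f -> smooth_expr U g.

Lemma smooth_expr_sum m (U : set 'rV[R]_m) n (F : 'I_n -> 'rV[R]_m -> R) :
  (forall i, smooth_expr U (F i)) -> smooth_expr U (fun u => \sum_(i < n) F i u).
Proof.
elim: n F => [|n IH] F sF.
  by under eq_fun do rewrite big_ord0; exact: SmoothCst.
under eq_fun do rewrite big_ord_recr /=.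
by apply: SmoothAdd => //; apply: IH => i; exact: sF.
Qed.

Lemma smooth_expr_derive m (U : set 'rV[R]_m) (f : 'rV[R]_m -> R) :
  open U -> smooth_expr U f ->
  (forall u, U u -> differentiable f u) /\
  (forall v, smooth_expr U ('D_v f)).
Proof.
move=> oU; elim=> {f}.
- move=> f sf; split=> [u Uu|v]; first exact: smooth_on_differentiable Uu.
  exact/SmoothBase/smooth_on_derive.
- move=> a; split=> [u _|v]; first exact: differentiable_cst.
  by apply: (@SmoothExt _ _ (fun=> 0)) (SmoothCst _ _) => u _; rewrite derive_cst.
- move=> f g sf [df Df] sg [dg Dg]; split=> [u Uu|v].
    by apply: differentiableD; [exact: df|exact: dg].
  apply: (@SmoothExt _ _ (fun u => 'D_v f u + 'D_v g u)); last exact: SmoothAdd.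
  move=> u Uu; rewrite deriveD//; apply: diff_derivable.
    exact: df.
  exact: dg.
- move=> f g sf [df Df] sg [dg Dg]; split=> [u Uu|v].
    by apply: differentiableM; [exact: df|exact: dg].
  apply: (@SmoothExt _ _ (fun u => f u * 'D_v g u + g u * 'D_v f u)).
    move=> u Uu; rewrite deriveM//; apply: diff_derivable.
      exact: df.
    exact: dg.
  by apply: SmoothAdd; apply: SmoothMul.
- move=> f sf [df Df] f0; split=> [u Uu|v].
    by apply: differentiableV; [exact: df|exact: f0].
  apply: (@SmoothExt _ _ (fun u => (- 1 * ((f u)^-1 * (f u)^-1)) * 'D_v f u)).
    move=> u Uu; rewrite deriveV; [|exact: f0|exact/diff_derivable/df].
    by rewrite -exprVn expr2 mulN1r.
  apply: SmoothMul => //; apply: SmoothMul; first exact: SmoothCst.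
  by apply: SmoothMul; exact: SmoothInv.
- move=> n V g f sg fV sf IH.
  have df u : U u -> differentiable f u.
    move=> Uu; apply/differentiable_mxP => i j; rewrite ord1.
    by have [/(_ _ Uu)] := IH j.
  have dg u : U u -> differentiable g (f u).
    by move=> Uu; apply: smooth_on_differentiable sg _; exact: fV.
  split=> [u Uu|v]; first by apply: differentiable_comp; [exact: df|exact: dg].
  apply: (@SmoothExt _ _ (fun u => \sum_(j < n)
      'D_v (fun y => f y 0 j) u * (pderive j g \o f) u)).
    move=> u Uu; rewrite derive_chain; [|exact: df|exact: dg].
    rewrite derive_partials; last exact: dg.
    by apply: eq_bigr => j _; rewrite derive_coord; last exact: df.
  apply: smooth_expr_sum => j; apply: SmoothMul; first by have [_] := IH j.
  by apply: (@SmoothComp _ _ _ V) => //; exact: smooth_on_derive.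
- move=> f g fg sf [df Df]; split=> [u Uu|v].
    apply: differentiable_near (df _ Uu).
    have : nbhs u U by exact: open_nbhs_nbhs.
    by apply: filterS => y Uy; apply: fg.
  apply: SmoothExt (Df v) => u Uu; apply: near_eq_derive.
  have : nbhs u U by exact: open_nbhs_nbhs.
  by apply: filterS => y Uy; apply: fg.
Qed.

(** By [smooth_expr_derive] the class is stable under directional derivatives, so
all iterated derivatives of a member are members, hence differentiable. *)
Lemma smooth_exprP m (U : set 'rV[R]_m) (f : 'rV[R]_m -> R) :
  open U -> smooth_expr U f -> smooth_on U f.
Proof.
move=> oU sf vs.
have : smooth_expr U (iter_derive vs f).
  by elim: vs => //= v vs IH; have [_] := smooth_expr_derive oU IH; apply.
by move=> /(smooth_expr_derive oU)[+ _] u Uu; exact.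
Qed.

Lemma smooth_onD m (U : set 'rV[R]_m) (f g : 'rV[R]_m -> R) : open U ->
  smooth_on U f -> smooth_on U g -> smooth_on U (fun u => f u + g u).
Proof.
by move=> oU sf sg; apply: smooth_exprP => //; apply: SmoothAdd; exact: SmoothBase.
Qed.

Lemma smooth_onM m (U : set 'rV[R]_m) (f g : 'rV[R]_m -> R) : open U ->
  smooth_on U f -> smooth_on U g -> smooth_on U (fun u => f u * g u).
Proof.
by move=> oU sf sg; apply: smooth_exprP => //; apply: SmoothMul; exact: SmoothBase.
Qed.

Lemma smooth_on_cst m (U : set 'rV[R]_m) (a : R) : open U ->
  smooth_on U (fun=> a).
Proof. by move=> oU; apply: smooth_exprP => //; exact: SmoothCst. Qed.

Lemma smooth_onV m (U : set 'rV[R]_m) (f : 'rV[R]_m -> R) : open U ->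
  smooth_on U f -> (forall u, U u -> f u != 0) -> smooth_on U (fun u => (f u)^-1).
Proof.
by move=> oU sf f0; apply: smooth_exprP => //; apply: SmoothInv => //; exact: SmoothBase.
Qed.

Lemma smooth_on_bigsum m (U : set 'rV[R]_m) I (r : seq I)
    (F : I -> 'rV[R]_m -> R) : open U -> (forall i, smooth_on U (F i)) ->
  smooth_on U (fun u => \sum_(i <- r) F i u).
Proof.
move=> oU sF; elim: r => [|i r IH].
  by under eq_fun do rewrite big_nil; exact: smooth_on_cst.
by under eq_fun do rewrite big_cons; exact: smooth_onD.
Qed.

Lemma smooth_on_bigprod m (U : set 'rV[R]_m) I (r : seq I)
    (F : I -> 'rV[R]_m -> R) : open U -> (forall i, smooth_on U (F i)) ->
  smooth_on U (fun u => \prod_(i <- r) F i u).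
Proof.
move=> oU sF; elim: r => [|i r IH].
  by under eq_fun do rewrite big_nil; exact: smooth_on_cst.
by under eq_fun do rewrite big_cons; exact: smooth_onM.
Qed.

(** The iterated derivatives of a matrix-valued map are computed entrywise as long
as they are differentiable, and differentiability is itself entrywise; the two
facts feed each other along the list of directions. *)
Lemma smooth_mxP m (U : set 'rV[R]_m) p q (F : 'rV[R]_m -> 'M[R]_(p, q)) :
  open U ->
  smooth_on U F <-> forall i j, smooth_on U (fun u => F u i j).
Proof.
move=> oU.
have nearU u : U u -> \forall y \near u, U y by move=> Uu; exact: open_nbhs_nbhs.
have step vs : (forall u, U u -> differentiable (iter_derive vs F) u) ->
    (forall u i j, U u ->
       iter_derive vs (fun y => F y i j) u = iter_derive vs F u i j) ->
    forall v u i j, U u ->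
       iter_derive (v :: vs) (fun y => F y i j) u = iter_derive (v :: vs) F u i j.
  move=> dF eF v u i j Uu; rewrite /= derive_coord; last exact: dF.
  by apply: near_eq_derive; apply: filterS (nearU u Uu) => y; exact: eF.
split=> [sF i j|sF].
  have eF vs : forall u i j, U u ->
      iter_derive vs (fun y => F y i j) u = iter_derive vs F u i j.
    by elim: vs => // v vs IH u k l; apply: step => // y; exact: sF.
  move=> vs u Uu; apply: differentiable_near (differentiable_entry i j (sF vs u Uu)).
  by apply: filterS (nearU u Uu) => y Uy; rewrite -eF.
have H vs : (forall u i j, U u ->
      iter_derive vs (fun y => F y i j) u = iter_derive vs F u i j) ->
    forall u, U u -> differentiable (iter_derive vs F) u.
  move=> eF u Uu; apply/differentiable_mxP => i j.
  apply: differentiable_near (sF i j vs u Uu).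
  by apply: filterS (nearU u Uu) => y; exact: eF.
have eF vs : forall u i j, U u ->
    iter_derive vs (fun y => F y i j) u = iter_derive vs F u i j.
  by elim: vs => // v vs IH u k l; apply: step => //; exact: H.
by move=> vs; exact/H/eF.
Qed.

Lemma smooth_comp m n p q (U : set 'rV[R]_m) (V : set 'rV[R]_n)
    (G : 'rV[R]_n -> 'M[R]_(p, q)) (f : 'rV[R]_m -> 'rV[R]_n) :
  open U -> open V -> smooth_on V G -> smooth_on U f ->
  (forall u, U u -> V (f u)) -> smooth_on U (fun u => G (f u)).
Proof.
move=> oU oV /(smooth_mxP _ oV) sG /(smooth_mxP _ oU) sf fUV.
apply/smooth_mxP => // i j; apply: smooth_exprP => //.
apply: (@SmoothComp _ _ _ V (fun y => G y i j)) => // k.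
exact: SmoothBase.
Qed.

Lemma smooth_mulmx m p q r (U : set 'rV[R]_m) (F : 'rV[R]_m -> 'M[R]_(p, q))
    (G : 'rV[R]_m -> 'M[R]_(q, r)) : open U ->
  smooth_on U F -> smooth_on U G -> smooth_on U (fun u => F u *m G u).
Proof.
move=> oU /(smooth_mxP _ oU) sF /(smooth_mxP _ oU) sG.
apply/smooth_mxP => // i j; under eq_fun do rewrite mxE.
by apply: smooth_on_bigsum => // k; exact: smooth_onM.
Qed.

Lemma smooth_addmx m p q (U : set 'rV[R]_m) (F G : 'rV[R]_m -> 'M[R]_(p, q)) :
  open U -> smooth_on U F -> smooth_on U G -> smooth_on U (fun u => F u + G u).
Proof.
move=> oU /(smooth_mxP _ oU) sF /(smooth_mxP _ oU) sG.
by apply/smooth_mxP => // i j; under eq_fun do rewrite mxE; exact: smooth_onD.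
Qed.

Lemma smooth_scalemx m p q (U : set 'rV[R]_m) (a : 'rV[R]_m -> R)
    (F : 'rV[R]_m -> 'M[R]_(p, q)) :
  open U -> smooth_on U a -> smooth_on U F -> smooth_on U (fun u => a u *: F u).
Proof.
move=> oU sa /(smooth_mxP _ oU) sF.
by apply/smooth_mxP => // i j; under eq_fun do rewrite mxE; exact: smooth_onM.
Qed.

Lemma smooth_trmx m p q (U : set 'rV[R]_m) (F : 'rV[R]_m -> 'M[R]_(p, q)) :
  open U -> smooth_on U F -> smooth_on U (fun u => (F u)^T).
Proof.
move=> oU /(smooth_mxP _ oU) sF.
by apply/smooth_mxP => // i j; under eq_fun do rewrite mxE; exact: sF.
Qed.

Lemma smooth_det m p (U : set 'rV[R]_m) (F : 'rV[R]_m -> 'M[R]_p) : open U ->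
  (forall i j, smooth_on U (fun u => F u i j)) -> smooth_on U (fun u => \det (F u)).
Proof.
move=> oU sF; rewrite /determinant.
apply: smooth_on_bigsum => // s; apply: smooth_onM => //; first exact: smooth_on_cst.
by apply: smooth_on_bigprod.
Qed.

(** Cramer's rule exhibits the entries as quotients of polynomials in the entries
of the matrix. *)
Lemma smooth_invmx m p (U : set 'rV[R]_m) (F : 'rV[R]_m -> 'M[R]_p) : open U ->
  smooth_on U F -> (forall u, U u -> F u \in unitmx) ->
  smooth_on U (fun u => invmx (F u)).
Proof.
move=> oU /(smooth_mxP _ oU) sF Fu.
apply: (@smooth_on_ext _ _ _ (fun u => (\det (F u))^-1 *: \adj (F u))) => //.
  by move=> u /Fu Uu; rewrite /invmx Uu.
apply: smooth_scalemx => //.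
  apply: smooth_onV => //; first exact: smooth_det.
  by move=> u /Fu; rewrite unitmxE unitfE.
apply/smooth_mxP => // i j; under eq_fun do rewrite mxE /cofactor.
apply: smooth_onM => //; first exact: smooth_on_cst.
by apply: smooth_det => // k l; under eq_fun do rewrite !mxE; exact: sF.
Qed.
End SmoothClosure.

(** * Inner products and Christoffel symbols of a metric *)

(** The directional derivative. It is sealed, like the tensors below, so that
terms with different directions are told apart without unfolding limits. *)
HB.lock Definition dd {R : realType} {V W : normedModType R} (v : V)
  (f : V -> W) (u : V) : W := 'D_v f u.
HB.lock Definition inner {R : realType} {n : nat} (A : 'M[R]_n)
  (X Y : 'rV[R]_n) : R := (X *m A *m Y^T) 0 0.
(** The Levi-Civita connection on constant vector fields: Gamma(X, Y) at y. *)
HB.lock Definition gamma {R : realType} {n : nat} (K : 'rV[R]_n -> 'M[R]_n)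
  (y X Y : 'rV[R]_n) : 'rV[R]_n := christoffel_form K y X Y.

Lemma ddE {R : realType} {V W : normedModType R} (v : V) (f : V -> W) (u : V) :
  dd v f u = 'D_v f u.
Proof. by rewrite dd.unlock. Qed.

Lemma pderiveE {R : realType} {W : normedModType R} m i (f : 'rV[R]_m -> W) u :
  pderive i f u = dd (delta_mx 0 i) f u.
Proof. by rewrite ddE. Qed.

Section InnerProduct.
Context {R : realType} {n : nat}.
Implicit Types (A : 'M[R]_n) (X Y Z : 'rV[R]_n).

Lemma innerDl A X Y Z : inner A (X + Y) Z = inner A X Z + inner A Y Z.
Proof. by rewrite inner.unlock !mulmxDl mxE. Qed.

Lemma innerDr A X Y Z : inner A X (Y + Z) = inner A X Y + inner A X Z.
Proof. by rewrite inner.unlock linearD mulmxDr mxE. Qed.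

Lemma innerZl A a X Z : inner A (a *: X) Z = a * inner A X Z.
Proof. by rewrite inner.unlock -!scalemxAl mxE. Qed.

Lemma innerZr A a X Z : inner A X (a *: Z) = a * inner A X Z.
Proof. by rewrite inner.unlock linearZ -scalemxAr mxE. Qed.

Lemma innerNl A X Z : inner A (- X) Z = - inner A X Z.
Proof. by rewrite -scaleN1r innerZl mulN1r. Qed.

Lemma innerNr A X Z : inner A X (- Z) = - inner A X Z.
Proof. by rewrite -scaleN1r innerZr mulN1r. Qed.

Lemma inner0l A Z : inner A 0 Z = 0.
Proof. by rewrite -(scale0r 0) innerZl mul0r. Qed.

Lemma inner0r A Z : inner A Z 0 = 0.
Proof. by rewrite -(scale0r 0) innerZr mul0r. Qed.

Lemma inner_suml A I (r : seq I) (F : I -> 'rV[R]_n) Z :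
  inner A (\sum_(i <- r) F i) Z = \sum_(i <- r) inner A (F i) Z.
Proof.
elim: r => [|i r IH]; first by rewrite !big_nil inner0l.
by rewrite !big_cons innerDl IH.
Qed.

Lemma inner_sumr A I (r : seq I) (F : I -> 'rV[R]_n) Z :
  inner A Z (\sum_(i <- r) F i) = \sum_(i <- r) inner A Z (F i).
Proof.
elim: r => [|i r IH]; first by rewrite !big_nil inner0r.
by rewrite !big_cons innerDr IH.
Qed.

Lemma inner_sym A X Y : A^T = A -> inner A X Y = inner A Y X.
Proof.
move=> sA; rewrite inner.unlock -[in LHS](trmxK (X *m A *m Y^T)) mxE.
by rewrite !trmx_mul trmxK sA mulmxA.
Qed.

Lemma inner_delta A i j : inner A (delta_mx 0 i) (delta_mx 0 j) = A i j.
Proof. by rewrite inner.unlock -rowE trmx_delta -colE !mxE. Qed.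

Lemma inner_addA A B X Y : inner (A + B) X Y = inner A X Y + inner B X Y.
Proof. by rewrite inner.unlock mulmxDr mulmxDl mxE. Qed.

Lemma inner0A X Y : inner 0 X Y = 0.
Proof. by rewrite inner.unlock mulmx0 mul0mx mxE. Qed.

Lemma inner_invmx A X Y : A \in unitmx ->
  inner A (X *m invmx A) Y = (X *m Y^T) 0 0.
Proof. by move=> uA; rewrite inner.unlock mulmxKV. Qed.

Lemma inner_scaleA A a X Y : inner (a *: A) X Y = a * inner A X Y.
Proof. by rewrite inner.unlock -scalemxAr -scalemxAl mxE. Qed.

Lemma innerE A X Y : inner A X Y = \sum_i \sum_j A i j * X 0 i * Y 0 j.
Proof.
rewrite {1}(row_sum_delta X) inner_suml; apply: eq_bigr => i _.
rewrite {1}(row_sum_delta Y) inner_sumr; apply: eq_bigr => j _.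
by rewrite innerZl innerZr inner_delta mulrA mulrC mulrA.
Qed.

Lemma inner_inj A X Y : A \in unitmx -> A^T = A ->
  (forall Z, inner A X Z = inner A Y Z) -> X = Y.
Proof.
move=> uA sA XY; suff : X *m A = Y *m A.
  by move=> /(congr1 (mulmx^~ (invmx A))); rewrite /= !mulmxK.
apply/rowP => j; have := XY (delta_mx 0 j).
by rewrite inner.unlock trmx_delta -!colE !mxE.
Qed.
End InnerProduct.

(** Inner products become variables, so that [ring], [field] and [lra] compare them
syntactically only. *)
Ltac inner_atoms := repeat match goal with
  | |- context [inner ?A ?X ?Y] => generalize (inner A X Y); intro end.

Section Christoffel.
Context {R : realType} {n : nat}.
Variables (K : 'rV[R]_n -> 'M[R]_n) (y : 'rV[R]_n).
Hypotheses (dK : differentiable K y) (uK : K y \in unitmx) (sK : (K y)^T = K y).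
Implicit Types (X Y Z : 'rV[R]_n).
Local Notation T X Y Z := (inner (dd X K y) Y Z).
Local Notation e := (delta_mx 0).

Lemma dmetricE X Y Z : T X Y Z = \sum_i X 0 i * inner (dd (e i) K y) Y Z.
Proof.
rewrite ddE derive_partials//; elim/big_rec2 : _ => [|i a b _ <-].
  by rewrite inner0A.
by rewrite inner_addA inner_scaleA pderiveE.
Qed.

(** Before the index is raised, Gamma(X, Y) is the linear form
Z |-> (D_X K(Y, Z) + D_Y K(X, Z) - D_Z K(X, Y)) / 2; here it is evaluated on the
coordinate vectors. *)
Lemma gammaE X Y : gamma K y X Y =
  2^-1 *: (\row_l (T X Y (e l) + T Y X (e l) - T (e l) X Y)) *m (invmx (K y))^T.
Proof.
apply/rowP => k; rewrite gamma.unlock !mxE.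
under eq_bigr => i _ do under eq_bigr => j _ do
  rewrite /christoffel mulr_sumr -mulrA mulr_suml.
under eq_bigr => i _ do under eq_bigr => j _ do
  under eq_bigr => l _ do rewrite !pderiveE.
under eq_bigr => i _ do rewrite exchange_big /=.
rewrite exchange_big /=; apply: eq_bigr => l _; rewrite !mxE.
rewrite (dmetricE X) (dmetricE Y).
have -> : \sum_i X 0 i * inner (dd (e i) K y) Y (e l) =
    \sum_i \sum_j dd (e i) K y j l * (X 0 i * Y 0 j).
  apply: eq_bigr => i _; rewrite {1}(row_sum_delta Y) inner_suml mulr_sumr.
  by apply: eq_bigr => j _; rewrite innerZl inner_delta; ring.
have -> : \sum_i Y 0 i * inner (dd (e i) K y) X (e l) =
    \sum_i \sum_j dd (e j) K y i l * (X 0 i * Y 0 j).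
  rewrite exchange_big; apply: eq_bigr => i _.
  rewrite {1}(row_sum_delta X) inner_suml mulr_sumr.
  by apply: eq_bigr => j _; rewrite innerZl inner_delta; ring.
have -> : T (e l) X Y = \sum_i \sum_j dd (e l) K y i j * (X 0 i * Y 0 j).
  by rewrite innerE; apply: eq_bigr => i _; apply: eq_bigr => j _; rewrite mulrA.
rewrite -big_split -sumrB /= mulr_sumr mulr_suml; apply: eq_bigr => i _.
rewrite -big_split -sumrB /= mulr_sumr mulr_suml; apply: eq_bigr => j _.
by ring.
Qed.

(** The Koszul formula for constant vector fields, whose brackets vanish. It is
the only property of the Christoffel symbols used below, besides bilinearity
and smoothness. *)
Lemma inner_gamma X Y Z : inner (K y) (gamma K y X Y) Z =
  2^-1 * (T X Y Z + T Y X Z - T Z X Y).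
Proof.
rewrite gammaE trmx_inv sK -scalemxAl innerZl inner_invmx//.
congr (_ * _).
have -> : T X Y Z = \sum_l Z 0 l * T X Y (e l).
  rewrite {1}(row_sum_delta Z) inner_sumr.
  by apply: eq_bigr => l _; rewrite innerZr.
have -> : T Y X Z = \sum_l Z 0 l * T Y X (e l).
  rewrite {1}(row_sum_delta Z) inner_sumr.
  by apply: eq_bigr => l _; rewrite innerZr.
have -> : T Z X Y = \sum_l Z 0 l * T (e l) X Y by exact: dmetricE.
rewrite mxE; transitivity (\sum_l (Z 0 l * T X Y (e l) + Z 0 l * T Y X (e l)
    - Z 0 l * T (e l) X Y)).
  by apply: eq_bigr => l _; rewrite !mxE mulrC mulrBr mulrDr.
by rewrite sumrB big_split.
Qed.

Lemma gamma_inner X Y k :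
  gamma K y X Y 0 k = inner (\matrix_(i, j) christoffel K y k i j) X Y.
Proof.
rewrite gamma.unlock mxE innerE; apply: eq_bigr => i _; apply: eq_bigr => j _.
by rewrite !mxE.
Qed.

Lemma gammaDl X Y Z : gamma K y (X + Y) Z =
  gamma K y X Z + gamma K y Y Z.
Proof. by apply/rowP => k; rewrite [RHS]mxE !gamma_inner innerDl. Qed.

Lemma gammaDr X Y Z : gamma K y X (Y + Z) =
  gamma K y X Y + gamma K y X Z.
Proof. by apply/rowP => k; rewrite [RHS]mxE !gamma_inner innerDr. Qed.

Lemma gammaZl a X Y : gamma K y (a *: X) Y =
  a *: gamma K y X Y.
Proof. by apply/rowP => k; rewrite [RHS]mxE !gamma_inner innerZl. Qed.

Lemma gammaZr a X Y : gamma K y X (a *: Y) =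
  a *: gamma K y X Y.
Proof. by apply/rowP => k; rewrite [RHS]mxE !gamma_inner innerZr. Qed.

Hypothesis sDK : forall X, (dd X K y)^T = dd X K y.

Lemma gammaC X Y : gamma K y X Y = gamma K y Y X.
Proof.
apply: (inner_inj uK sK) => Z; rewrite !inner_gamma.
by rewrite [T X Y Z + _]addrC [T Z X Y](inner_sym _ _ (sDK Z)).
Qed.

(** The two instances of the Koszul formula on the right-hand side add up to the
derivative of the metric: the other terms cancel in pairs. *)
Lemma metric_compatible X Y Z : T Z X Y =
  inner (K y) (gamma K y Z X) Y + inner (K y) X (gamma K y Z Y).
Proof.
rewrite [inner (K y) X _](inner_sym _ _ sK) !inner_gamma.
rewrite (inner_sym Y X (sDK Z)).
by inner_atoms; field.
Qed.
End Christoffel.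

Lemma differentiable_inner {R : realType} {V : normedModType R} n
    (A : V -> 'M[R]_n) (X Y : V -> 'rV[R]_n) u :
  differentiable A u -> differentiable X u -> differentiable Y u ->
  differentiable (fun u => inner (A u) (X u) (Y u)) u.
Proof.
rewrite inner.unlock => dA dX dY; apply: differentiable_entry.
by do 2?apply: differentiable_mulmx => //; exact: differentiable_trmx.
Qed.

Lemma derive_inner {R : realType} {V : normedModType R} n
    (A : V -> 'M[R]_n) (X Y : V -> 'rV[R]_n) u v :
  differentiable A u -> differentiable X u -> differentiable Y u ->
  dd v (fun u => inner (A u) (X u) (Y u)) u =
  inner (dd v A u) (X u) (Y u) + inner (A u) (dd v X u) (Y u)
  + inner (A u) (X u) (dd v Y u).
Proof.
rewrite !ddE inner.unlock => dA dX dY; have dYT := differentiable_trmx dY.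
have dXA := differentiable_mulmx dX dA.
rewrite -derive_coord; last exact: differentiable_mulmx.
rewrite derive_mulmx// derive_mulmx// derive_trmx// mulmxDl !mxE.
by congr (_ + _); rewrite addrC; congr (_ + _); rewrite mxE.
Qed.

(** * Covariant derivatives along a map, and curvature *)

Section DirectionalDerivative.
Context {R : realType} {V W : normedModType R}.
Implicit Types (f g : V -> W) (u v w : V).

Lemma dd_near f g v u : (\forall y \near u, f y = g y) -> dd v f u = dd v g u.
Proof. by rewrite !ddE; exact: near_eq_derive. Qed.

Lemma ddD f g v u : differentiable f u -> differentiable g u ->
  dd v (fun y => f y + g y) u = dd v f u + dd v g u.
Proof. by rewrite !ddE => df dg; rewrite -deriveD//; exact: diff_derivable. Qed.

Lemma ddB f g v u : differentiable f u -> differentiable g u ->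
  dd v (fun y => f y - g y) u = dd v f u - dd v g u.
Proof. by rewrite !ddE => df dg; rewrite -deriveB//; exact: diff_derivable. Qed.

Lemma ddZ (a : R) f v u : differentiable f u ->
  dd v (fun y => a *: f y) u = a *: dd v f u.
Proof. by rewrite !ddE => df; rewrite -deriveZ//; exact: diff_derivable. Qed.

Lemma dd_cst (a : W) v u : dd v (fun=> a) u = 0.
Proof. by rewrite ddE derive_cst. Qed.

Lemma dd_chain (U : normedModType R) (f : V -> U) (g : U -> W) v u :
  differentiable f u -> differentiable g (f u) ->
  dd v (fun y => g (f y)) u = dd (dd v f u) g (f u).
Proof. by rewrite !ddE => df dg; rewrite -derive_chain. Qed.

Lemma dd_dirD f v w u : differentiable f u -> dd (v + w) f u = dd v f u + dd w f u.
Proof. by rewrite !ddE; exact: derive_dirD. Qed.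

Lemma dd_dirZ a f v u : differentiable f u -> dd (a *: v) f u = a *: dd v f u.
Proof. by rewrite !ddE; exact: derive_dirZ. Qed.

Lemma dd_coord p q (M : V -> 'M[R]_(p, q)) u v i j :
  differentiable M u -> dd v M u i j = dd v (fun y => M y i j) u.
Proof. by rewrite !ddE; exact: derive_coord. Qed.

Lemma dd_trmx p q (M : V -> 'M[R]_(p, q)) u v :
  differentiable M u -> dd v (fun y => (M y)^T) u = (dd v M u)^T.
Proof. by rewrite !ddE; exact: derive_trmx. Qed.
End DirectionalDerivative.

Lemma dd_id {R : realType} {V : normedModType R} (v u : V) : dd v id u = v.
Proof. by rewrite ddE derive_id. Qed.

Section SmoothDD.
Context {R : realType} {m : nat}.
Variable U : set 'rV[R]_m.
Hypothesis oU : open U.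

Lemma nbhsU u : U u -> \forall y \near u, U y.
Proof. by move=> Uu; exact: open_nbhs_nbhs. Qed.

Lemma smooth_dd (W : normedModType R) (f : 'rV[R]_m -> W) v :
  smooth_on U f -> smooth_on U (dd v f).
Proof.
rewrite (_ : dd v f = 'D_v f); first exact: smooth_on_derive.
by apply/funext => u; rewrite ddE.
Qed.

(** Entrywise, this is the symmetry of second derivatives. *)
Lemma ddC p q (F : 'rV[R]_m -> 'M[R]_(p, q)) v w u : smooth_on U F -> U u ->
  dd v (dd w F) u = dd w (dd v F) u.
Proof.
move=> sF Uu; apply/matrixP => i j.
have sFij := (smooth_mxP F oU).1 sF i j.
have dF x : U x -> forall z, differentiable (dd z F) x.
  by move=> Ux z; apply: smooth_on_differentiable (smooth_dd z sF) Ux.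
have E x y : dd x (dd y F) u i j = dd x (dd y (fun u => F u i j)) u.
  rewrite dd_coord; last exact: dF.
  apply: dd_near; apply: filterS (nbhsU Uu) => z Uz.
  by rewrite dd_coord//; exact: smooth_on_differentiable sF Uz.
rewrite !E; set g := fun _ => _.
have -> : dd w g = 'D_w g by apply/funext => x; rewrite ddE.
have -> : dd v g = 'D_v g by apply/funext => x; rewrite ddE.
rewrite !ddE; apply: derive_comm.
- by apply: filterS (nbhsU Uu) => y; exact: smooth_on_differentiable.
- exact: smooth_on_differentiable (smooth_on_derive v sFij) Uu.
- exact: smooth_on_differentiable (smooth_on_derive w sFij) Uu.
Qed.

Lemma smooth_cstmx p q (C : 'M[R]_(p, q)) : smooth_on U (fun=> C).
Proof. by apply/smooth_mxP => // i j; exact: smooth_on_cst. Qed.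

Lemma smooth_id : smooth_on U id.
Proof.
apply/smooth_mxP => // i j vs; case/lastP: vs => [|vs v] u Uu.
  exact: differentiable_coord.
rewrite /iter_derive foldr_rcons (_ : (fun _ => _) = fun=> v i j).
  exact: (smooth_on_cst (v i j) oU vs Uu).
by apply/funext => y; rewrite -derive_coord// derive_id.
Qed.

Lemma smooth_inner n (A : 'rV[R]_m -> 'M[R]_n) (X Y : 'rV[R]_m -> 'rV[R]_n) :
  smooth_on U A -> smooth_on U X -> smooth_on U Y ->
  smooth_on U (fun u => inner (A u) (X u) (Y u)).
Proof.
rewrite inner.unlock => sA sX sY.
have : smooth_on U (fun u => X u *m A u *m (Y u)^T).
  by apply: smooth_mulmx => //; [exact: smooth_mulmx|exact: smooth_trmx].
by move=> /(smooth_mxP _ oU); apply.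
Qed.
End SmoothDD.

(** A Riemannian metric on an open set of coordinates; metrics of manifolds in
charts are of this kind, and the local theory does not mention manifolds. *)
Record local_metric {R : realType} {n : nat} (V : set 'rV[R]_n)
    (K : 'rV[R]_n -> 'M[R]_n) : Prop := LocalMetric {
  lm_open : open V;
  lm_smooth : smooth_on V K;
  lm_sym : forall y, V y -> (K y)^T = K y;
  lm_pos : forall y X, V y -> X != 0 -> 0 < inner (K y) X X
}.

(** The pull-back connection nabla^f in the constant direction v. *)
HB.lock Definition covd {R : realType} {m n : nat} (K : 'rV[R]_n -> 'M[R]_n)
    (f : 'rV[R]_m -> 'rV[R]_n) (v : 'rV[R]_m) (A : 'rV[R]_m -> 'rV[R]_n)
    (u : 'rV[R]_m) : 'rV[R]_n :=
  dd v A u + gamma K (f u) (dd v f u) (A u).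

(** R(X, Y) Z for constant X, Y and Z, that is,
nabla_X nabla_Y Z - nabla_Y nabla_X Z; this form does not expand the vectors in
the coordinate basis. *)
HB.lock Definition curv {R : realType} {n : nat} (K : 'rV[R]_n -> 'M[R]_n)
    (y X Y Z : 'rV[R]_n) : 'rV[R]_n :=
  dd X (fun z => gamma K z Y Z) y + gamma K y X (gamma K y Y Z)
  - (dd Y (fun z => gamma K z X Z) y + gamma K y Y (gamma K y X Z)).

Section LocalMetric.
Context {R : realType} {n : nat} {V : set 'rV[R]_n} {K : 'rV[R]_n -> 'M[R]_n}.
Hypothesis lm : local_metric V K.
Implicit Types (X Y Z W y : 'rV[R]_n).
Let oV := lm_open lm.
Let sK := lm_smooth lm.

Lemma lm_diff y : V y -> differentiable K y.
Proof. exact: smooth_on_differentiable. Qed.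

Lemma lm_unit y : V y -> K y \in unitmx.
Proof.
move=> Vy; rewrite -row_free_unit; apply: inj_row_free => v v0.
apply/eqP/negP => /negP /(lm_pos lm Vy).
by rewrite inner.unlock v0 mul0mx mxE ltxx.
Qed.

Lemma lm_dd_sym y X : V y -> (dd X K y)^T = dd X K y.
Proof.
move=> Vy; rewrite -dd_trmx; last exact: lm_diff.
by apply: dd_near; apply: filterS (nbhsU oV Vy) => z; exact: lm_sym.
Qed.

Lemma lm_dd2_sym y X Y : V y -> (dd X (dd Y K) y)^T = dd X (dd Y K) y.
Proof.
move=> Vy; rewrite -dd_trmx; last first.
  exact: smooth_on_differentiable (smooth_dd Y sK) Vy.
by apply: dd_near; apply: filterS (nbhsU oV Vy) => z; exact: lm_dd_sym.
Qed.

Lemma smooth_christoffel_mx k :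
  smooth_on V (fun y => \matrix_(i, j) christoffel K y k i j).
Proof.
apply/smooth_mxP => // i j; under eq_fun do rewrite mxE /christoffel.
have sI := (smooth_mxP _ oV).1 (smooth_invmx oV sK lm_unit).
have sP a b c : smooth_on V (fun y => pderive a K y b c).
  exact: (smooth_mxP _ oV).1 (smooth_on_derive _ sK) b c.
apply: smooth_onM => //; first exact: smooth_on_cst.
apply: smooth_on_bigsum => // l; apply: smooth_onM => //.
apply: smooth_onD => //; first exact: smooth_onD.
under eq_fun do rewrite -mulN1r.
by apply: smooth_onM => //; exact: smooth_on_cst.
Qed.

Lemma smooth_gamma_cst X Y : smooth_on V (fun y => gamma K y X Y).
Proof.
apply/smooth_mxP => // i k; rewrite ord1.
under eq_fun do rewrite gamma_inner; apply: smooth_inner => //.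
- exact: smooth_christoffel_mx.
- exact: smooth_cstmx.
- exact: smooth_cstmx.
Qed.

Section AlongMap.
Context {m : nat} {U : set 'rV[R]_m} {f : 'rV[R]_m -> 'rV[R]_n}.
Hypotheses (oU : open U) (sf : smooth_on U f) (fUV : forall u, U u -> V (f u)).
Implicit Types (A B : 'rV[R]_m -> 'rV[R]_n).

Lemma smooth_gamma A B : smooth_on U A -> smooth_on U B ->
  smooth_on U (fun u => gamma K (f u) (A u) (B u)).
Proof.
move=> sA sB; apply/smooth_mxP => // i k; rewrite ord1.
under eq_fun do rewrite gamma_inner; apply: smooth_inner => //.
exact: (smooth_comp oU oV (smooth_christoffel_mx k)).
Qed.

(** Chain rule for the trilinear dependence on the base point f and on the two
fields; the last term differentiates the Christoffel symbols alone. *)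
Lemma dd_gamma A B v u : smooth_on U A -> smooth_on U B -> U u ->
  dd v (fun u => gamma K (f u) (A u) (B u)) u =
  gamma K (f u) (dd v A u) (B u) + gamma K (f u) (A u) (dd v B u)
  + dd (dd v f u) (fun y => gamma K y (A u) (B u)) (f u).
Proof.
move=> sA sB Uu; apply/rowP => k.
have dA := smooth_on_differentiable sA Uu.
have dB := smooth_on_differentiable sB Uu.
have df := smooth_on_differentiable sf Uu.
pose C y := \matrix_(i, j) christoffel K y k i j : 'M[R]_n.
have dC : differentiable C (f u).
  exact: smooth_on_differentiable (smooth_christoffel_mx k) (fUV Uu).
have dCf : differentiable (fun u => C (f u)) u by exact: differentiable_comp.
rewrite dd_coord; last exact: smooth_on_differentiable (smooth_gamma sA sB) Uu.
rewrite (_ : (fun _ => _) = fun u => inner (C (f u)) (A u) (B u)); last first.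
  by apply/funext => x; exact: gamma_inner.
rewrite derive_inner// dd_chain// [RHS]mxE [X in _ = X + _]mxE !gamma_inner.
rewrite [RHS]addrC addrA; congr (_ + _ + _).
rewrite dd_coord; last exact: smooth_on_differentiable (smooth_gamma_cst _ _) (fUV Uu).
rewrite (_ : (fun _ => _) = fun y => inner (C y) (A u) (B u)); last first.
  by apply/funext => x; exact: gamma_inner.
rewrite derive_inner//; [|exact: differentiable_cst..].
by rewrite !dd_cst inner0l inner0r !addr0.
Qed.

Lemma smooth_covd v A : smooth_on U A -> smooth_on U (covd K f v A).
Proof.
move=> sA; rewrite covd.unlock; apply: smooth_addmx => //; first exact: smooth_dd.
by apply: smooth_gamma => //; exact: smooth_dd.
Qed.

Lemma covdD v A B u : smooth_on U A -> smooth_on U B -> U u ->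
  covd K f v (fun u => A u + B u) u = covd K f v A u + covd K f v B u.
Proof.
move=> sA sB Uu; rewrite covd.unlock ddD ?gammaDr; first by rewrite addrACA.
- exact: smooth_on_differentiable sA Uu.
- exact: smooth_on_differentiable sB Uu.
Qed.

(** Chain rule along f, and [metric_compatible]. *)
Lemma dd_metric A B v u : smooth_on U A -> smooth_on U B -> U u ->
  dd v (fun u => inner (K (f u)) (A u) (B u)) u =
  inner (K (f u)) (covd K f v A u) (B u) + inner (K (f u)) (A u) (covd K f v B u).
Proof.
move=> sA sB Uu; have Vfu := fUV Uu.
have dA := smooth_on_differentiable sA Uu.
have dB := smooth_on_differentiable sB Uu.
have df := smooth_on_differentiable sf Uu.
have dK := lm_diff Vfu.
have dKf : differentiable (fun u => K (f u)) u by exact: differentiable_comp.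
rewrite derive_inner// dd_chain//.
rewrite (metric_compatible dK (lm_unit Vfu) (lm_sym lm Vfu)) => [|X]; last exact: lm_dd_sym.
by rewrite covd.unlock innerDl innerDr; inner_atoms; ring.
Qed.

(** The second derivatives of f are symmetric, and so are the Christoffel
symbols. *)
Lemma covd_torsion_free v w u : U u -> covd K f v (dd w f) u = covd K f w (dd v f) u.
Proof.
move=> Uu; have Vfu := fUV Uu; rewrite covd.unlock (ddC oU v w sf Uu); congr (_ + _).
apply: (gammaC (lm_diff Vfu) (lm_unit Vfu) (lm_sym lm Vfu)) => X.
exact: lm_dd_sym.
Qed.

(** After expanding both sides, the second derivatives of A and of f agree by
symmetry, the mixed first-order terms are exchanged, and only the derivatives of
the Christoffel symbols and their products are left. *)
Lemma covd_comm v w A u : smooth_on U A -> U u ->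
  covd K f v (covd K f w A) u - covd K f w (covd K f v A) u =
  curv K (f u) (dd v f u) (dd w f u) (A u).
Proof.
move=> sA Uu.
have H a b : covd K f a (covd K f b A) u =
    dd a (dd b A) u + gamma K (f u) (dd a (dd b f) u) (A u)
    + gamma K (f u) (dd b f u) (dd a A u) + gamma K (f u) (dd a f u) (dd b A u)
    + (dd (dd a f u) (fun y => gamma K y (dd b f u) (A u)) (f u)
       + gamma K (f u) (dd a f u) (gamma K (f u) (dd b f u) (A u))).
  rewrite [LHS](_ : _ = dd a (covd K f b A) u
    + gamma K (f u) (dd a f u) (covd K f b A u)); last first.
    by rewrite {1}covd.unlock.
  have sbf := smooth_dd b sf; have sbA := smooth_dd b sA.
  rewrite covd.unlock ddD; last 2 first.
  - exact: smooth_on_differentiable sbA Uu.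
  - exact: smooth_on_differentiable (smooth_gamma sbf sA) Uu.
  rewrite (dd_gamma _ sbf sA Uu) gammaDr.
  by rewrite !addrA; congr (_ + _); rewrite -!addrA; do 3! congr (_ + _); rewrite addrC.
rewrite !H (ddC oU v w sA Uu) (ddC oU v w sf Uu) curv.unlock.
set x1 := dd w _ _; set x2 := gamma _ _ _ _; set x3 := gamma _ _ _ _.
set x4 := gamma _ _ _ _.
have cancel (p q r : 'rV[R]_n) : p + q - (p + r) = q - r.
  by rewrite opprD addrACA subrr add0r.
by rewrite [x1 + x2 + x4 + x3]addrAC cancel.
Qed.
End AlongMap.

Section CurvatureAt.
Variable y : 'rV[R]_n.
Hypothesis Vy : V y.
Local Notation D2 X Y Z W := (inner (dd X (dd Y K) y) Z W).
Local Notation T X Y Z := (inner (dd X K y) Y Z).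
Local Notation e := (delta_mx 0).
Let diffV (W : normedModType R) (F : 'rV[R]_n -> W) :
  smooth_on V F -> differentiable F y.
Proof. by move=> sF; exact: smooth_on_differentiable sF Vy. Qed.

Lemma metric_compatible_at X Y Z : T Z X Y =
  inner (K y) (gamma K y Z X) Y + inner (K y) X (gamma K y Z Y).
Proof.
apply: metric_compatible; [exact: diffV|exact: lm_unit|exact: (lm_sym lm)|].
by move=> W; exact: lm_dd_sym.
Qed.

(** Differentiating the Koszul formula in the direction X also differentiates the
metric on the left-hand side, which is the source of the last term. *)
Lemma inner_dd_gamma X Y Z W :
  inner (K y) (dd X (fun z => gamma K z Y Z) y) W =
  2^-1 * (D2 X Y Z W + D2 X Z Y W - D2 X W Y Z) - T X (gamma K y Y Z) W.
Proof.
have sG := smooth_gamma_cst Y Z.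
have dG := diffV sG.
have dTT a b c : differentiable (fun z => inner (dd a K z) b c) y.
  by apply: differentiable_inner; [exact/diffV/smooth_dd|exact: differentiable_cst..].
have DT a b c : dd X (fun z => inner (dd a K z) b c) y = D2 X a b c.
  rewrite derive_inner ?dd_cst ?inner0l ?inner0r ?addr0//; try exact: differentiable_cst.
  by apply/diffV/smooth_dd.
have : dd X (fun z => inner (K z) (gamma K z Y Z) W) y =
    dd X (fun z => 2^-1 *: (inner (dd Y K z) Z W + inner (dd Z K z) Y W
      - inner (dd W K z) Y Z)) y.
  apply: dd_near; apply: filterS (nbhsU oV Vy) => z Vz.
  by apply: inner_gamma; [exact: lm_diff|exact: lm_unit|exact: (lm_sym lm)].
rewrite derive_inner; [|exact: diffV|exact: dG|exact: differentiable_cst].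
rewrite dd_cst inner0r addr0 ddZ; last first.
  by apply: differentiableB => //; exact: differentiableD.
rewrite ddB//; last exact: differentiableD.
rewrite ddD// !DT => E.
by apply: (addrI (T X (gamma K y Y Z) W)); rewrite E [RHS]addrC subrK.
Qed.

(** The classical expression of the curvature by second derivatives of the metric
and products of Christoffel symbols; the terms D_X D_Y K(Z, W) cancel. *)
Lemma inner_curv X Y Z W : inner (K y) (curv K y X Y Z) W =
  2^-1 * (D2 X Z Y W - D2 X W Y Z - D2 Y Z X W + D2 Y W X Z)
  - inner (K y) (gamma K y Y Z) (gamma K y X W)
  + inner (K y) (gamma K y X Z) (gamma K y Y W).
Proof.
rewrite curv.unlock innerDl innerNl !innerDl !inner_dd_gamma.
rewrite !metric_compatible_at (ddC oV X Y sK Vy).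
by inner_atoms; ring.
Qed.

(** In the expression [inner_curv] the exchange of (X, Y) with (Z, W) permutes the
terms, because second derivatives of the metric are symmetric in both pairs of
arguments. *)
Lemma curv_pair_symmetry X Y Z W :
  inner (K y) (curv K y X Y Z) W = inner (K y) (curv K y Z W X) Y.
Proof.
rewrite !inner_curv (ddC oV Z X sK Vy) (ddC oV Z Y sK Vy).
rewrite (ddC oV W X sK Vy) (ddC oV W Y sK Vy).
have sD a b := lm_dd2_sym a b Vy; have sKy := lm_sym lm Vy.
have gC a b : gamma K y a b = gamma K y b a.
  apply: gammaC; [exact: diffV|exact: lm_unit|exact: (lm_sym lm)|].
  by move=> c; exact: lm_dd_sym.
rewrite (inner_sym W Y (sD X Z)) (inner_sym Z Y (sD X W)).
rewrite (inner_sym W X (sD Y Z)) (inner_sym Z X (sD Y W)).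
rewrite (gC Z X) (gC W Y) (gC W X) (gC Z Y) (inner_sym (gamma K y X W) _ sKy).
by inner_atoms; ring.
Qed.

Lemma curv_anti X Y Z : curv K y X Y Z = - curv K y Y X Z.
Proof. by rewrite curv.unlock opprB. Qed.

Lemma curvDl X X' Y Z : curv K y (X + X') Y Z = curv K y X Y Z + curv K y X' Y Z.
Proof.
rewrite curv.unlock dd_dirD; last exact: diffV (smooth_gamma_cst _ _).
rewrite (_ : (fun z => gamma K z (X + X') Z) =
    fun z => gamma K z X Z + gamma K z X' Z); last first.
  by apply/funext => z; rewrite gammaDl.
rewrite ddD; [|exact: diffV (smooth_gamma_cst _ _)..].
rewrite !gammaDl gammaDr [in RHS]addrACA -opprD.
by congr (_ - _); rewrite addrACA.
Qed.

Lemma curvZl a X Y Z : curv K y (a *: X) Y Z = a *: curv K y X Y Z.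
Proof.
rewrite curv.unlock dd_dirZ; last exact: diffV (smooth_gamma_cst _ _).
rewrite (_ : (fun z => gamma K z (a *: X) Z) = fun z => a *: gamma K z X Z); last first.
  by apply/funext => z; rewrite gammaZl.
rewrite ddZ; last exact: diffV (smooth_gamma_cst _ _).
by rewrite !gammaZl gammaZr scalerBr !scalerDr.
Qed.

Lemma curvDr X Y Z Z' : curv K y X Y (Z + Z') = curv K y X Y Z + curv K y X Y Z'.
Proof.
have H a b : dd a (fun z => gamma K z b (Z + Z')) y =
    dd a (fun z => gamma K z b Z) y + dd a (fun z => gamma K z b Z') y.
  rewrite -ddD; [|exact: diffV (smooth_gamma_cst _ _)..].
  by congr (dd _ _ _); apply/funext => z; rewrite gammaDr.
rewrite curv.unlock !H !gammaDr [in RHS]addrACA -opprD.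
by congr (_ - _); rewrite addrACA.
Qed.

Lemma curvZr a X Y Z : curv K y X Y (a *: Z) = a *: curv K y X Y Z.
Proof.
have H c b : dd c (fun z => gamma K z b (a *: Z)) y =
    a *: dd c (fun z => gamma K z b Z) y.
  rewrite -ddZ; last exact: diffV (smooth_gamma_cst _ _).
  by congr (dd _ _ _); apply/funext => z; rewrite gammaZr.
by rewrite curv.unlock !H !gammaZr scalerBr !scalerDr.
Qed.

Lemma covE m (f : 'rV[R]_m -> 'rV[R]_n) i A : cov K f i A = covd K f (e i) A.
Proof. by apply/funext => u; rewrite covd.unlock gamma.unlock !dd.unlock. Qed.

Lemma rowV_expand (F : 'rV[R]_n -> 'rV[R]_n) X :
  (forall Y Z, F (Y + Z) = F Y + F Z) -> (forall a Y, F (a *: Y) = a *: F Y) ->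
  F X = \sum_i X 0 i *: F (e i).
Proof.
move=> FD FZ; rewrite {1}(row_sum_delta X).
have F0 : F 0 = 0 by have := FZ 0 0; rewrite !scale0r.
by rewrite (big_morph F FD F0); apply: eq_bigr => i _; rewrite FZ.
Qed.

(** On coordinate vectors both sides are the commutator of the covariant
derivatives along the identity map; the general case follows by
trilinearity. *)
Lemma curvatureE X Y Z : curvature K y X Y Z = curv K y X Y Z.
Proof.
rewrite (rowV_expand (F := fun X => curv K y X Y Z));
  [|exact: (fun a b => curvDl a b Y Z)|exact: (fun a b => curvZl a b Y Z)].
apply: eq_bigr => i _.
rewrite curv_anti (rowV_expand (F := fun Y => curv K y Y (e i) Z));
  [|exact: (fun a b => curvDl a b _ Z)|exact: (fun a b => curvZl a b _ Z)].
rewrite -sumrN scaler_sumr; apply: eq_bigr => j _.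
rewrite -scalerN -curv_anti (rowV_expand (F := fun Z => curv K y (e i) (e j) Z));
  [|exact: curvDr|by move=> a b; exact: curvZr].
rewrite !scaler_sumr; apply: eq_bigr => k _; rewrite !scalerA; congr (_ *: _).
rewrite !covE (covd_comm oV (smooth_id oV) _ _ _ (smooth_cstmx oV _) Vy)//.
by rewrite !dd_id.
Qed.
End CurvatureAt.
End LocalMetric.

(** * The second fundamental form of a map *)

(** nabla d f (v, w) for constant v and w. Unlike the components on coordinate
vectors it can be evaluated at the rows of a Jacobian, as changes of
coordinates require. *)
HB.lock Definition sff {R : realType} {m n : nat} (G : 'rV[R]_m -> 'M[R]_m)
    (K : 'rV[R]_n -> 'M[R]_n) (f : 'rV[R]_m -> 'rV[R]_n) (v w u : 'rV[R]_m) :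
    'rV[R]_n :=
  covd K f v (dd w f) u - dd (gamma G u v w) f u.

Section Immersion.
Context {R : realType} {m n : nat}.
Context {U : set 'rV[R]_m} {G : 'rV[R]_m -> 'M[R]_m}.
Context {V : set 'rV[R]_n} {K : 'rV[R]_n -> 'M[R]_n}.
Context {f : 'rV[R]_m -> 'rV[R]_n}.
Hypotheses (lG : local_metric U G) (lK : local_metric V K).
Hypotheses (sf : smooth_on U f) (fUV : forall u, U u -> V (f u)).
Local Notation e := (delta_mx 0).
Implicit Types (u v w x : 'rV[R]_m).
Let oU := lm_open lG.

Lemma second_ffE u i j : U u -> second_ff G K f u i j = sff G K f (e i) (e j) u.
Proof.
move=> Uu; rewrite sff.unlock /second_ff covE; congr (_ - _).
  by congr covd; apply/funext => y; exact: pderiveE.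
rewrite [RHS]ddE derive_partials; last exact: smooth_on_differentiable sf Uu.
apply: eq_bigr => k _; congr (_ *: _).
(* Gamma(e_i, e_j) has the Christoffel symbols as its components. *)
rewrite gamma.unlock mxE (bigD1 i)//= (bigD1 j)//= !big1 ?addr0.
- by rewrite !mxE !eqxx !mulr1.
- by move=> l li; rewrite big1// => p _; rewrite !mxE (negbTE li) !eqxx mulr0 mul0r.
- by move=> l lj; rewrite !mxE (negbTE lj) !eqxx mulr0.
Qed.

Lemma sffC v w u : U u -> sff G K f v w u = sff G K f w v u.
Proof.
move=> Uu; rewrite sff.unlock (covd_torsion_free lK oU sf fUV _ _ Uu).
congr (_ - dd _ _ _); apply: gammaC.
- exact: (lm_diff lG).
- exact: (lm_unit lG).
- exact: (lm_sym lG).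
- by move=> X; exact: (lm_dd_sym lG).
Qed.

Lemma sffDl v v' w u : U u ->
  sff G K f (v + v') w u = sff G K f v w u + sff G K f v' w u.
Proof.
move=> Uu; have df := smooth_on_differentiable sf Uu.
have ddf := smooth_on_differentiable (smooth_dd w sf) Uu.
rewrite sff.unlock covd.unlock !dd_dirD// !gammaDl dd_dirD//.
by rewrite [in RHS]addrACA -opprD; congr (_ - _); rewrite addrACA.
Qed.

Lemma sffZl a v w u : U u -> sff G K f (a *: v) w u = a *: sff G K f v w u.
Proof.
move=> Uu; have df := smooth_on_differentiable sf Uu.
have ddf := smooth_on_differentiable (smooth_dd w sf) Uu.
rewrite sff.unlock covd.unlock !dd_dirZ// !gammaZl dd_dirZ//.
by rewrite scalerBr scalerDr.
Qed.

Definition isometric := forall u v w, U u ->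
  inner (K (f u)) (dd v f u) (dd w f u) = inner (G u) v w.

(** Differentiating <df(b), df(c)> = G(b, c) and combining three such identities
as in the Koszul formula gives <nabla_v df(w), df(x)> = G(Gamma(v, w), x), which
is <df(Gamma(v, w)), df(x)>. *)
Lemma sff_normal v w x u : isometric -> U u ->
  inner (K (f u)) (sff G K f v w u) (dd x f u) = 0.
Proof.
move=> iso Uu; have Vfu := fUV Uu.
have dG := lm_diff lG Uu.
have H a b c : inner (dd a G u) b c =
    inner (K (f u)) (covd K f a (dd b f) u) (dd c f u) +
    inner (K (f u)) (dd b f u) (covd K f a (dd c f) u).
  rewrite -(dd_metric lK sf fUV)//; [|exact: smooth_dd..].
  transitivity (dd a (fun u => inner (G u) b c) u).
    rewrite derive_inner//; [|exact: differentiable_cst..].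
    by rewrite !dd_cst inner0l inner0r !addr0.
  by apply: dd_near; apply: filterS (nbhsU oU Uu) => z Uz; rewrite iso.
rewrite sff.unlock innerDl innerNl iso//.
rewrite (inner_gamma dG (lm_unit lG Uu) (lm_sym lG Uu)) !H.
have sK := lm_sym lK Vfu.
(* Torsion-freeness identifies the six terms in pairs; all pairs but the
   one of nabla_v df(w) cancel. *)
have cT (a b : 'rV[R]_m) : covd K f a (dd b f) u = covd K f b (dd a f) u.
  exact: (covd_torsion_free lK oU sf fUV a b Uu).
rewrite (inner_sym (dd w f u) _ sK) (inner_sym (dd v f u) _ sK).
rewrite (cT w v) (cT x w) (cT x v) (inner_sym (dd v f u) _ sK).
by inner_atoms; field.
Qed.
End Immersion.

Section DerivativeMatrix.
Context {R : realType} {n p : nat} {V : set 'rV[R]_n}.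
Context {chi : 'rV[R]_n -> 'rV[R]_p}.
Hypotheses (oV : open V) (schi : smooth_on V chi).

(** The Jacobian matrix, acting on row vectors from the right, with its entries
written as derivatives so that its smoothness can be read off. *)
Definition dmat (y : 'rV[R]_n) : 'M[R]_(n, p) :=
  \matrix_(i, j) dd (delta_mx 0 i) chi y 0 j.

Lemma dd_dmat b y : V y -> dd b chi y = b *m dmat y.
Proof.
move=> Vy; rewrite ddE derive_partials; last exact: smooth_on_differentiable schi Vy.
rewrite mulmx_sum_row; apply: eq_bigr => i _; congr (_ *: _).
by rewrite pderiveE; apply/rowP => j; rewrite !mxE.
Qed.

Lemma smooth_dmat : smooth_on V dmat.
Proof.
apply/smooth_mxP => // i j; under eq_fun do rewrite mxE.
by have /(smooth_mxP _ oV) := smooth_dd (delta_mx 0 i) schi; apply.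
Qed.

(** The direction b x of the outer derivative depends on x: product rule for
b x *m dmat chi (f x). *)
Lemma dd_moving_direction m (U : set 'rV[R]_m) (f b : 'rV[R]_m -> 'rV[R]_n) v u :
  open U -> smooth_on U f -> smooth_on U b -> (forall u, U u -> V (f u)) -> U u ->
  dd v (fun x => dd (b x) chi (f x)) u =
  dd (dd v b u) chi (f u) + dd (dd v f u) (dd (b u) chi) (f u).
Proof.
move=> oU sf sb fUV Uu; have Vfu := fUV _ Uu.
have df := smooth_on_differentiable sf Uu.
have db := smooth_on_differentiable sb Uu.
have dJ := smooth_on_differentiable smooth_dmat Vfu.
have dJf : differentiable (fun x => dmat (f x)) u by exact: differentiable_comp.
transitivity (dd v (fun x => b x *m dmat (f x)) u).
  by apply: dd_near; apply: filterS (nbhsU oU Uu) => z Uz; apply/dd_dmat/fUV.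
rewrite {1}ddE derive_mulmx// -!ddE (dd_chain v df dJ) -dd_dmat//; congr (_ + _).
transitivity (dd (dd v f u) (fun y => b u *m dmat y) (f u)).
  by rewrite [RHS]ddE derive_mulmx// -!ddE dd_cst mul0mx add0r.
by apply: dd_near; apply: filterS (nbhsU oV Vfu) => z Vz; rewrite dd_dmat.
Qed.
End DerivativeMatrix.
Arguments dmat {R n p} chi y.

Section Composition.
Context {R : realType} {m n p : nat}.
Context {U : set 'rV[R]_m} {G : 'rV[R]_m -> 'M[R]_m}.
Context {V : set 'rV[R]_n} {K : 'rV[R]_n -> 'M[R]_n}.
Context {K' : 'rV[R]_p -> 'M[R]_p}.
Context {f : 'rV[R]_m -> 'rV[R]_n} {chi : 'rV[R]_n -> 'rV[R]_p}.
Hypotheses (oU : open U) (oV : open V).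
Hypotheses (sf : smooth_on U f) (fUV : forall u, U u -> V (f u)).
Hypotheses (schi : smooth_on V chi).

(** nabla d(chi o f) = dchi(nabla df) + (nabla dchi)(df, df): the Christoffel
symbols of the intermediate metric K enter both terms on the right and
cancel. *)
Lemma sff_comp v w u : U u ->
  sff G K' (fun x => chi (f x)) v w u =
  dd (sff G K f v w u) chi (f u) + sff K K' chi (dd v f u) (dd w f u) (f u).
Proof.
move=> Uu; have Vfu := fUV Uu.
have df := smooth_on_differentiable sf Uu.
have dchi := smooth_on_differentiable schi Vfu.
have H a x : U x -> dd a (fun x => chi (f x)) x = dd (dd a f x) chi (f x).
  move=> Ux; apply: dd_chain; first exact: smooth_on_differentiable sf Ux.
  exact: smooth_on_differentiable schi (fUV Ux).
rewrite !sff.unlock !covd.unlock !H//.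
have -> : dd v (dd w (fun x => chi (f x))) u =
    dd (dd v (dd w f) u) chi (f u) + dd (dd v f u) (dd (dd w f u) chi) (f u).
  rewrite -(dd_moving_direction oV schi _ oU sf (smooth_dd w sf) fUV Uu).
  by apply: dd_near; apply: filterS (nbhsU oU Uu) => z; exact: H.
have ddN a : dd (- a) chi (f u) = - dd a chi (f u).
  by rewrite -scaleN1r dd_dirZ// scaleN1r.
rewrite !dd_dirD// ddN.
set x1 := dd (dd v _ _) _ _; set x2 := dd (dd v _ _) _ _; set x3 := gamma _ _ _ _.
set x4 := dd (dd _ _ _) _ _; set x5 := dd (gamma _ _ _ _) _ _.
by rewrite (addrAC x1 x5) addrACA subrr addr0 (addrAC x1 (- x4)) addrA.
Qed.
End Composition.

Section Isometry.
Context {R : realType} {n : nat}.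
Context {V V' : set 'rV[R]_n} {K K' : 'rV[R]_n -> 'M[R]_n}.
Context {chi : 'rV[R]_n -> 'rV[R]_n}.
Hypotheses (lK : local_metric V K) (lK' : local_metric V' K').
Hypotheses (schi : smooth_on V chi) (chiV : forall y, V y -> V' (chi y)).
Hypothesis iso : @isometric _ _ _ V K K' chi.

Lemma isometry_unit y : V y -> dmat chi y \in unitmx.
Proof.
move=> Vy; rewrite -row_free_unit; apply: inj_row_free => v v0.
apply/eqP/negP => /negP /(lm_pos lK Vy).
by rewrite -iso// (dd_dmat schi)// v0 inner0l ltxx.
Qed.

(** The second fundamental form is orthogonal to the image of the differential,
which is the whole space. *)
Lemma isometry_sff0 v w y : V y -> sff K K' chi v w y = 0.
Proof.
move=> Vy; have Vcy := chiV Vy.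
apply: (inner_inj (lm_unit lK' Vcy) (lm_sym lK' Vcy)) => Z.
have -> : Z = dd (Z *m invmx (dmat chi y)) chi y.
  by rewrite (dd_dmat schi)// mulmxKV//; exact: isometry_unit.
by rewrite (sff_normal lK lK' schi chiV)// inner0l.
Qed.
End Isometry.

(** * The tangential part of the biharmonic equation *)

Section TangentialBitension.
Context {R : realType} {m n : nat}.
Context {U : set 'rV[R]_m} {V : set 'rV[R]_n} {K : 'rV[R]_n -> 'M[R]_n}.
Context {f W : 'rV[R]_m -> 'rV[R]_n}.
Hypotheses (oU : open U) (lK : local_metric V K).
Hypotheses (sf : smooth_on U f) (fUV : forall u, U u -> V (f u)).
Hypotheses (sW : smooth_on U W).
Hypothesis W_normal : forall u x, U u -> inner (K (f u)) (W u) (dd x f u) = 0.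
Implicit Types (u v x : 'rV[R]_m).

(** For a normal field W this is <W, nabla df (v, x)>, because nabla df (v, x)
and nabla_v df(x) differ by a tangent vector. This form is easier to
differentiate. *)
Definition shape v x u := inner (K (f u)) (W u) (covd K f v (dd x f) u).

Let sdf x : smooth_on U (dd x f). Proof. exact: smooth_dd. Qed.
Let scdf v x : smooth_on U (covd K f v (dd x f)).
Proof. exact: (smooth_covd lK oU sf fUV v (sdf x)). Qed.
Let scW v : smooth_on U (covd K f v W).
Proof. exact: (smooth_covd lK oU sf fUV v sW). Qed.

Lemma smooth_shape v x : smooth_on U (shape v x).
Proof.
apply: smooth_inner => //.
exact: smooth_comp oU (lm_open lK) (lm_smooth lK) sf fUV.
Qed.

Lemma shapeC v x u : U u -> shape v x u = shape x v u.
Proof. by move=> Uu; rewrite /shape (covd_torsion_free lK oU sf fUV _ _ Uu). Qed.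

(** The derivative of <W, df(x)> = 0, the Weingarten equation. *)
Lemma inner_covd_normal v x u : U u ->
  inner (K (f u)) (covd K f v W u) (dd x f u) = - shape v x u.
Proof.
move=> Uu; apply/eqP; rewrite -addr_eq0; apply/eqP.
rewrite -(dd_metric lK sf fUV v sW (sdf x) Uu).
rewrite -(dd_cst (0 : R) v u); apply: dd_near.
by apply: filterS (nbhsU oU Uu) => z Uz; rewrite W_normal.
Qed.

(** Differentiating the Weingarten equation once more produces
<nabla_v W, nabla_v df(x)>. As nabla_v df(x) = nabla_x df(v), this is obtained
from the derivative of A(v, x) = <W, nabla_x df(v)>. The exchange of nabla_v and
nabla_x produces the curvature <R(df(v), df(x)) df(v), W>, which is
<R(df(v), W) df(v), df(x)> by pair symmetry. *)
Lemma tangential_hessian v x u : U u ->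
  inner (K (f u)) (covd K f v (covd K f v W) u
                   - curv K (f u) (dd v f u) (W u) (dd v f u)) (dd x f u) =
  inner (K (f u)) (W u) (covd K f x (covd K f v (dd v f)) u)
  - 2 * dd v (shape v x) u.
Proof.
move=> Uu; have Vfu := fUV Uu.
have E1 := dd_metric lK sf fUV v (scW v) (sdf x) Uu.
have E2 := dd_metric lK sf fUV v sW (scdf x v) Uu.
have E3 := covd_comm lK oU sf fUV v x (sdf v) Uu.
have {}E1 : - dd v (shape v x) u = inner (K (f u)) (covd K f v (covd K f v W) u) (dd x f u)
    + inner (K (f u)) (covd K f v W u) (covd K f v (dd x f) u).
  rewrite -E1 -scaleN1r -ddZ; last exact: smooth_on_differentiable (smooth_shape v x) Uu.
  apply: dd_near; apply: filterS (nbhsU oU Uu) => z Uz.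
  by rewrite inner_covd_normal// scaleN1r.
have {}E2 : dd v (shape v x) u = inner (K (f u)) (covd K f v W u) (covd K f x (dd v f) u)
    + inner (K (f u)) (W u) (covd K f v (covd K f x (dd v f)) u).
  rewrite -E2; apply: dd_near; apply: filterS (nbhsU oU Uu) => z Uz.
  by rewrite shapeC.
move/eqP: E3; rewrite subr_eq => /eqP E3.
rewrite innerDl innerNl (curv_pair_symmetry lK Vfu).
rewrite E3 innerDr (inner_sym (W u) (curv _ _ _ _ _) (lm_sym lK Vfu)) in E2.
rewrite (covd_torsion_free lK oU sf fUV v x Uu) in E1.
move: E1 E2; inner_atoms; move: (dd v (shape v x) u) => d E1 E2; lra.
Qed.
End TangentialBitension.

Lemma sum_ord2 (M : nmodType) (F : 'I_2 -> M) : \sum_(i < 2) F i = F 0 + F 1.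
Proof. by rewrite !big_ord_recl big_ord0 addr0; congr (_ + F _); apply/val_inj. Qed.

Lemma gamma_delta {R : realType} {n : nat} (G : 'rV[R]_n -> 'M[R]_n) u i j k :
  gamma G u (delta_mx 0 i) (delta_mx 0 j) 0 k = christoffel G u k i j.
Proof. by rewrite gamma_inner inner_delta mxE. Qed.

Lemma inner_scalar_mx {R : realType} {n : nat} (a : R) (X Y : 'rV[R]_n) :
  inner a%:M X Y = a * (X *m Y^T) 0 0.
Proof. by rewrite -[a%:M]scalemx1 inner_scaleA inner.unlock mulmx1. Qed.

Lemma metric_trace_scalar {R : realType} {n : nat} (G : 'rV[R]_2 -> 'M[R]_2) u
    (a : R) (S : 'I_2 -> 'I_2 -> 'rV[R]_n) : G u = a%:M ->
  metric_trace G u S = a^-1 *: (S 0 0 + S 1 1).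
Proof.
move=> Ga; rewrite /metric_trace Ga invmx_scalar !sum_ord2 !mxE.
by rewrite !mulr1n !mulr0n !scale0r addr0 add0r -scalerDr.
Qed.

Section Conformal.
Context {R : realType} {n : nat}.
Context {U : set 'rV[R]_2} {G : 'rV[R]_2 -> 'M[R]_2}.
Context {V : set 'rV[R]_n} {K : 'rV[R]_n -> 'M[R]_n}.
Context {f : 'rV[R]_2 -> 'rV[R]_n}.
Hypotheses (lG : local_metric U G) (lK : local_metric V K).
Hypotheses (sf : smooth_on U f) (fUV : forall u, U u -> V (f u)).
Hypothesis iso : @isometric _ _ _ U G K f.
Let E u := G u 0 0.
Hypothesis conformal : forall u, U u -> G u = (E u)%:M.
Local Notation e := (delta_mx 0).
Local Notation W := (tension G K f).
Let oU := lm_open lG.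

Lemma conformal_factor_gt0 u : U u -> 0 < E u.
Proof.
move=> Uu; have := lm_pos lG (X := e 0) Uu; rewrite inner_delta; apply.
by apply/eqP => /rowP/(_ 0)/eqP; rewrite !mxE oner_eq0.
Qed.

Lemma smooth_conformal_factor : smooth_on U E.
Proof. by have /(smooth_mxP _ oU) := lm_smooth lG; apply. Qed.

(** In dimension two the coordinate functions of isothermal coordinates are
harmonic: the two derivatives of the conformal factor cancel. *)
Lemma conformal_trace_gamma u : U u -> gamma G u (e 0) (e 0) + gamma G u (e 1) (e 1) = 0.
Proof.
move=> Uu; have dG := lm_diff lG Uu.
have dE := smooth_on_differentiable smooth_conformal_factor Uu.
apply: (inner_inj (lm_unit lG Uu) (lm_sym lG Uu)) => Z.
have ddG X : dd X G u = (dd X E u)%:M.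
  apply/matrixP => i j; rewrite dd_coord// mxE.
  transitivity (dd X (fun u => (i == j)%:R *: E u) u).
    apply: dd_near; apply: filterS (nbhsU oU Uu) => y Uy.
    by rewrite conformal// mxE; case: (i == j); rewrite ?scale1r ?scale0r.
  by rewrite ddZ//; case: (i == j); rewrite ?scale1r ?scale0r.
have HZ : dd Z E u = Z 0 0 * dd (e 0) E u + Z 0 1 * dd (e 1) E u.
  by rewrite ddE derive_partials// sum_ord2 !pderiveE.
rewrite innerDl inner0l !(inner_gamma dG (lm_unit lG Uu) (lm_sym lG Uu)) !ddG.
rewrite !inner_scalar_mx HZ -!rowE.
rewrite !mxE !eqxx /=.
by move: (dd (e 0) E u) (dd (e 1) E u) (Z 0 0) (Z 0 1) => a b c d; field.
Qed.

(** The trace of nabla df with respect to the flat metric of the coordinates; the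
Christoffel symbols of the source drop out by [conformal_trace_gamma]. *)
Definition trace_hess u := covd K f (e 0) (dd (e 0) f) u + covd K f (e 1) (dd (e 1) f) u.

Lemma smooth_trace_hess : smooth_on U trace_hess.
Proof.
by apply: smooth_addmx => //; apply: (smooth_covd lK oU sf fUV _ (smooth_dd _ sf)).
Qed.

Lemma conformal_tension u : U u -> E u *: W u = trace_hess u.
Proof.
move=> Uu; rewrite /tension (metric_trace_scalar _ (conformal Uu)).
rewrite scalerA mulfV ?gt_eqF ?conformal_factor_gt0// scale1r.
rewrite !(second_ffE sf)// sff.unlock addrACA -opprD -dd_dirD; last first.
  exact: smooth_on_differentiable sf Uu.
by rewrite conformal_trace_gamma// ddE derive0 subr0.
Qed.

Lemma smooth_tension : smooth_on U W.
Proof.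
apply: (@smooth_on_ext _ _ _ _ (fun u => (E u)^-1 *: trace_hess u)) => //.
  move=> u Uu; rewrite -conformal_tension// scalerA mulVf ?scale1r//.
  by rewrite gt_eqF ?conformal_factor_gt0.
apply: smooth_scalemx => //; last exact: smooth_trace_hess.
apply: smooth_onV => //; first exact: smooth_conformal_factor.
by move=> u Uu; rewrite gt_eqF ?conformal_factor_gt0.
Qed.

Lemma tension_normal u x : U u -> inner (K (f u)) (W u) (dd x f u) = 0.
Proof.
move=> Uu; rewrite /tension (metric_trace_scalar _ (conformal Uu)).
rewrite innerZl innerDl !(second_ffE sf)//.
by rewrite !(sff_normal lG lK sf fUV)// addr0 mulr0.
Qed.

(** Up to the conformal factor, the biharmonic equation has the shape it has for
the flat metric: the Christoffel symbols of the source drop out of the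
Laplacian too. *)
Lemma conformal_bitension u : U u -> bitension G K f u = 0 ->
  covd K f (e 0) (covd K f (e 0) W) u - curv K (f u) (dd (e 0) f u) (W u) (dd (e 0) f u)
  + (covd K f (e 1) (covd K f (e 1) W) u
     - curv K (f u) (dd (e 1) f u) (W u) (dd (e 1) f u)) = 0.
Proof.
move=> Uu; have Vfu := fUV Uu.
rewrite /bitension /rough_laplacian !(metric_trace_scalar _ (conformal Uu)).
rewrite -scalerBr => /eqP; rewrite scaler_eq0 invr_eq0.
rewrite gt_eqF ?conformal_factor_gt0//= => /eqP.
(* The two correction terms of the Laplacian are opposite to each other. *)
have c k : christoffel G u k 1 1 = - christoffel G u k 0 0.
  have /rowP/(_ k) := conformal_trace_gamma Uu.
  by rewrite !mxE !gamma_delta => /eqP; rewrite addrC addr_eq0 => /eqP.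
under [X in _ + (_ - X)]eq_bigr => k _ do rewrite c scaleNr.
rewrite sumrN opprK addrACA addNr addr0 opprD addrACA.
have r i := curvatureE lK Vfu (pderive i f u) (W u) (pderive i f u).
by rewrite !covE (r 0) (r 1) !pderiveE.
Qed.

Let q u := inner (K (f u)) (W u) (W u).
Let A := @shape R 2 n K f W.

(** The two instances of [tangential_hessian] add up to zero by the biharmonic
equation. The sum of nabla_v df(v) is E W, and <W, nabla_x (E W)> is found
without differentiating E: it is the derivative of
<W, E W> = A_00 + A_11 minus <nabla_x W, E W> = (E / 2) d_x |W|^2. *)
Lemma conformal_stress_divergence u x : U u -> bitension G K f u = 0 ->
  2 * (dd (e 0) (A (e 0) x) u + dd (e 1) (A (e 1) x) u) =
  dd x (fun u => A (e 0) (e 0) u + A (e 1) (e 1) u) u - E u / 2 * dd x q u.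
Proof.
move=> Uu bi; have sW := smooth_tension.
have H v := tangential_hessian oU lK sf fUV sW tension_normal v x Uu.
have : inner (K (f u)) 0 (dd x f u) = 0 by rewrite inner0l.
rewrite -{1}(conformal_bitension Uu bi) innerDl !H.
have scv v := smooth_covd lK oU sf fUV v (smooth_dd v sf).
have -> : dd x (fun u => A (e 0) (e 0) u + A (e 1) (e 1) u) u =
    dd x (fun u => inner (K (f u)) (W u) (trace_hess u)) u.
  apply: dd_near; apply: filterS (nbhsU oU Uu) => z Uz.
  by rewrite innerDr.
rewrite (dd_metric lK sf fUV x sW smooth_trace_hess Uu).
rewrite -conformal_tension// innerZr.
have -> : covd K f x trace_hess u =
    covd K f x (covd K f (e 0) (dd (e 0) f)) u + covd K f x (covd K f (e 1) (dd (e 1) f)) u.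
  exact: covdD (scv _) (scv _) Uu.
have := dd_metric lK sf fUV x sW sW Uu.
rewrite -/(q u) -/q innerDr -/(A _ _).
rewrite [inner _ (W u) (covd K f x W u)](inner_sym _ _ (lm_sym lK (fUV Uu))).
move=> -> {bi H}; rewrite /A.
set I0 := inner _ _ (covd K f x (covd K f (e 0) _) u).
set I1 := inner _ _ (covd K f x (covd K f (e 1) _) u).
set I2 := inner _ _ _; set d0 := dd (e 0) _ u; set d1 := dd (e 1) _ u.
by move: I0 I1 I2 d0 d1 (E u) => {}I0 I1 I2 d0 d1 Eu; lra.
Qed.
End Conformal.

(** * Change of coordinates and locally constant functions *)

Lemma local_metric_sub {R : realType} {n : nat} (V V' : set 'rV[R]_n) K :
  open V' -> V' `<=` V -> local_metric V K -> local_metric V' K.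
Proof.
move=> oV' sub lm; split=> //.
- exact: smooth_on_subset sub (lm_smooth lm).
- by move=> y /sub; exact: lm_sym lm _.
- by move=> y X /sub; exact: lm_pos lm _ _.
Qed.

(** The second fundamental form at a point only depends on the germ of the map. *)
Lemma sff_ext {R : realType} {m n : nat} (U : set 'rV[R]_m) G K
    (f f' : 'rV[R]_m -> 'rV[R]_n) v w u : open U ->
  (forall x, U x -> f x = f' x) -> U u -> sff G K f v w u = sff G K f' v w u.
Proof.
move=> oU ff' Uu.
have H a x : U x -> dd a f x = dd a f' x.
  by move=> Ux; apply: dd_near; apply: filterS (nbhsU oU Ux).
rewrite sff.unlock covd.unlock !H// ff'//; congr (_ + _ - _).
by apply: dd_near; apply: filterS (nbhsU oU Uu) => x; exact: H.
Qed.

Lemma inner_mulmx {R : realType} {n p : nat} (A : 'M[R]_n) (B : 'M[R]_p)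
    (J : 'M[R]_(n, p)) X Y :
  J *m B *m J^T = A -> inner B (X *m J) (Y *m J) = inner A X Y.
Proof. by move=> <-; rewrite inner.unlock trmx_mul !mulmxA. Qed.

Section MetricTraceChange.
Context {R : realType} {m n : nat}.
Variables (S : 'rV[R]_m -> 'rV[R]_m -> 'rV[R]_n).
Hypotheses (SDl : forall X Y Z, S (X + Y) Z = S X Z + S Y Z).
Hypotheses (SZl : forall a X Z, S (a *: X) Z = a *: S X Z).
Hypotheses (SC : forall X Y, S X Y = S Y X).

Lemma bilinear_expand X Y : S X Y =
  \sum_i \sum_j (X 0 i * Y 0 j) *: S (delta_mx 0 i) (delta_mx 0 j).
Proof.
have S0 Z : S 0 Z = 0 by have := SZl 0 0 Z; rewrite !scale0r.
have expand Z T : S Z T = \sum_i Z 0 i *: S (delta_mx 0 i) T.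
  rewrite {1}(row_sum_delta Z) (big_morph (S^~ T) (fun a b => SDl a b T) (S0 T)).
  by apply: eq_bigr => i _; rewrite SZl.
rewrite expand; apply: eq_bigr => i _; rewrite SC expand scaler_sumr.
by apply: eq_bigr => j _; rewrite SC scalerA.
Qed.

(** The inverse metric transforms by the transpose of the Jacobian, inversely to
the arguments of a bilinear map. *)
Lemma metric_trace_change (G G' : 'rV[R]_m -> 'M[R]_m) u y (J : 'M[R]_m) :
  J *m G y *m J^T = G' u -> G y \in unitmx -> G' u \in unitmx ->
  metric_trace G' u (fun i j => S (row i J) (row j J)) =
  metric_trace G y (fun i j => S (delta_mx 0 i) (delta_mx 0 j)).
Proof.
move=> GG' uG uG'; rewrite /metric_trace.
have uJ : J \in unitmx.
  by move: uG'; rewrite -GG' !unitmx_mul => /andP[/andP[]].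
have -> : invmx (G y) = J^T *m invmx (G' u) *m J.
  have uJT : J^T \in unitmx by rewrite unitmx_tr.
  apply: (can_inj (mulmxK uG)); rewrite mulVmx// -(mulmxA _ J).
  have -> : J *m G y = G' u *m invmx J^T by rewrite -GG' mulmxK.
  by rewrite mulmxA mulmxKV// mulmxV.
rewrite !pair_bigA /=.
under eq_bigr => ij _ do rewrite bilinear_expand pair_bigA scaler_sumr /=.
rewrite exchange_big /=; apply: eq_bigr => -[a b] _ /=.
rewrite mxE; under [X in X *: _]eq_bigr => j _ do rewrite mxE mulr_suml.
rewrite exchange_big pair_bigA scaler_suml /=; apply: eq_bigr => -[i j] _ /=.
by rewrite scalerA !mxE; congr (_ *: _); ring.
Qed.
End MetricTraceChange.

(** The mean value theorem on segments inside a ball. *)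
Lemma locally_constant_of_zero_derivative {R : realType} {m : nat}
    (U : set 'rV[R]_m) (q : 'rV[R]_m -> R) u : open U -> U u ->
  (forall y, U y -> differentiable q y) ->
  (forall y i, U y -> dd (delta_mx 0 i) q y = 0) ->
  \forall y \near u, q y = q u.
Proof.
move=> oU Uu dq dq0.
have /nbhs_ballP[r /= r0 rU] : nbhs u U by exact: open_nbhs_nbhs.
apply/nbhs_ballP; exists r => // y uy.
have seg (t : R) : t \in `[0, 1] -> U (t *: (y - u) + u).
  rewrite in_itv /= => /andP[t0 t1]; apply: rU; move: uy.
  rewrite -!ball_normE /= distrC => uy; rewrite distrC addrK normrZ ger0_norm//.
  by apply: le_lt_trans uy; rewrite ler_piMl.
have zero z : U z -> 'D_(y - u) q z = 0.
  move=> Uz; rewrite derive_partials; last exact: dq.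
  by rewrite big1// => i _; rewrite pderiveE dq0// scaler0.
have dseg (t : R) : t \in `[0, 1] -> is_derive t 1 (fun r : R => q (r *: (y - u) + u)) 0.
  by move=> t01; rewrite -(zero _ (seg t t01)); exact/is_derive_line/dq/seg.
pose g (t : R) := q (t *: (y - u) + u).
have g01 : (0 : R) < 1 by exact: ltr01.
have dg (t : R) : t \in `]0, 1[ -> is_derive t 1 g 0.
  by move=> t01; apply: dseg; exact: subset_itv_oo_cc.
have cg : {within `[0, 1], continuous g}.
  by apply: derivable_within_continuous => t t01; have [] := dseg t t01.
have [c _] := MVT g01 dg cg.
rewrite mul0r /g scale1r subrK scale0r add0r => /eqP.
by rewrite subr_eq0 => /eqP.
Qed.

(** The level set of p is open, and so is its complement in A. *)
Lemma connected_locally_constant {T : topologicalType} {S : Type} (A : set T)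
    (F : T -> S) : connected A -> open A ->
  (forall p, A p -> \forall q \near p, F q = F p) ->
  forall p q, A p -> A q -> F p = F q.
Proof.
move=> cA oA lc p q Ap Aq.
pose B := [set x | A x /\ F x = F p].
have oset (P : S -> Prop) : open [set x | A x /\ P (F x)].
  rewrite openE => x [Ax Px]; rewrite /interior.
  have nA : nbhs x A by exact: open_nbhs_nbhs.
  by apply: filterS2 nA (lc x Ax) => y Ay Fy; split=> //; rewrite Fy.
suff BA : B = A by move: Aq; rewrite -BA => -[].
apply: cA.
- by exists p.
- exists B; first exact: (oset (fun s => s = F p)).
  by apply/seteqP; split=> x [].
- exists (~` [set x | A x /\ F x <> F p]).
    by apply: open_closedC; exact: (oset (fun s => s <> F p)).
  apply/seteqP; split=> x /=; first by move=> [Ax Fx]; split=> // -[_ /(_ Fx)].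
  by move=> [Ax nx]; split=> //; apply: contrapT => Fx; apply: nx.
Qed.

(** * The Cauchy-Riemann equations *)

Section CauchyRiemann.
Context {R : realType}.
Implicit Types (z w h : R[i]) (P Q : 'rV[R]_2 -> R).

(** The identification of the complex plane with the coordinate plane that is
used by [zfun] and [zinv]. *)
Definition zrow z : 'rV[R]_2 :=
  \row_(i < 2) if i == 0 then complex.Re z else complex.Im z.

(** The complex modulus as an element of the real field; the norm of the field of
complex numbers takes values in that field itself. *)
Definition cnorm z : R := complex.Re `|z|.

Lemma zrowD z w : zrow (z + w) = zrow z + zrow w.
Proof. by apply/rowP => i; rewrite !mxE; case: z w (i == 0) => [a b] [c d] []. Qed.

Lemma zrowZ (t : R) z : zrow (t%:C%C * z) = t *: zrow z.
Proof.
apply/rowP => i; rewrite !mxE; case: z => [a b] /=.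
by rewrite !mul0r subr0 addr0; case: (i == 0).
Qed.

Lemma normcE z : `|z| = (cnorm z)%:C%C.
Proof. by rewrite /cnorm normc_def. Qed.

Lemma cnorm_ge0 z : 0 <= cnorm z.
Proof. by rewrite /cnorm normc_def /= sqrtr_ge0. Qed.

Lemma Re_le_cnorm z : `|complex.Re z| <= cnorm z.
Proof. by rewrite -lecR -normcE normc_ge_Re. Qed.

Lemma Im_le_cnorm z : `|complex.Im z| <= cnorm z.
Proof.
rewrite /cnorm normc_def /= -[leLHS]sqrtr_sqr//.
by rewrite ler_sqrt ?addr_ge0 ?sqr_ge0// lerDr sqr_ge0.
Qed.

Lemma cnorm_le (a b : R) : cnorm (Complex a b) <= `|a| + `|b|.
Proof.
have s0 : 0 <= `|a| + `|b| by rewrite addr_ge0.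
rewrite /cnorm normc_def /= -[leRHS]ger0_norm// -sqrtr_sqr ler_sqrt ?sqr_ge0//.
rewrite sqrrD -[a ^+ 2]real_normK ?num_real// -[b ^+ 2]real_normK ?num_real//.
by rewrite lerD2r lerDl mulrn_wge0 ?mulr_ge0.
Qed.

Lemma zrow_norm_le z : `|zrow z| <= cnorm z.
Proof.
rewrite /Num.Def.normr /= mx_normrE; apply/bigmax_leP; split=> [|[i j] _ /=].
  exact: cnorm_ge0.
by rewrite mxE; case: ifP => _; [exact: Re_le_cnorm|exact: Im_le_cnorm].
Qed.

Lemma cnormM z w : cnorm (z * w) = cnorm z * cnorm w.
Proof. by apply: complexI; rewrite -normcE normrM !normcE rmorphM. Qed.

Lemma cnormN z : cnorm (- z) = cnorm z.
Proof. by rewrite /cnorm normrN. Qed.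

Lemma cnorm_gt0 z : z != 0 -> 0 < cnorm z.
Proof. by rewrite -normr_gt0 normcE ltcR. Qed.

Lemma cnorm_real (t : R) : cnorm t%:C%C = `|t|.
Proof. by rewrite /cnorm normc_def /= expr0n /= addr0 sqrtr_sqr. Qed.

Lemma complex_differential P v (u : 'rV[R]_2) : differentiable P u ->
  dd v P u = v 0 0 * dd (delta_mx 0 0) P u + v 0 1 * dd (delta_mx 0 1) P u.
Proof. by move=> dP; rewrite ddE derive_partials// sum_ord2 !pderiveE. Qed.

Variables (F : R[i] -> R[i]) (P Q : 'rV[R]_2 -> R) (w0 : R[i]).
Let u0 := zrow w0.
Hypotheses (dP : differentiable P u0) (dQ : differentiable Q u0).
Hypothesis FPQ : \forall u \near u0,
  F (Complex ((u : 'rV[R]_2) 0 0) (u 0 1)) = Complex (P u) (Q u).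
Local Notation e := (delta_mx 0).
Local Notation dF := (fun h : R[i] => F (h + w0) - F w0).

Lemma zrow_complex z : Complex (zrow z 0 0) (zrow z 0 1) = z.
Proof. by rewrite !mxE; case: z. Qed.

Lemma near_FPQ : exists2 r : R, 0 < r & forall h, cnorm h < r ->
  dF h = Complex (P (zrow h + u0) - P u0) (Q (zrow h + u0) - Q u0).
Proof.
have := FPQ => /nbhs_ballP[r /= r0 rF]; exists r => // h hr.
have E z : cnorm z < r -> F (z + w0) = Complex (P (zrow z + u0)) (Q (zrow z + u0)).
  move=> zr; rewrite -zrowD -[in LHS](zrow_complex (z + w0)); apply: rF.
  rewrite -ball_normE /= zrowD distrC addrK; exact: le_lt_trans (zrow_norm_le z) zr.
have z0 : zrow 0 = 0 by apply/rowP => i; rewrite !mxE; case: (i == 0).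
have := E 0; rewrite -{1}[0]/(0%:C%C) cnorm_real normr0 add0r z0 add0r => -> //.
by rewrite E.
Qed.

Lemma linear_approximation P' : differentiable P' u0 -> forall k : R, 0 < k ->
  exists2 r : R, 0 < r & forall v : 'rV[R]_2, `|v| < r ->
    `|P' (v + u0) - P' u0 - dd v P' u0| <= k * `|v|.
Proof.
move=> dP' k k0; have /eqaddoP/(_ k k0)/nbhs_ballP[r /= r0 rP] := diff_locally dP'.
exists r => // v vr; have := rP v; rewrite -ball_normE /= sub0r normrN => /(_ vr).
by rewrite !fctE /= opprD addrA ddE deriveE.
Qed.

(** By the Cauchy-Riemann equations the real differential of F is the
multiplication by the complex number d_0 P + i d_0 Q, so that the expansion of P
and Q to first order is a complex first-order expansion of F. *)
Lemma complex_derivable_of_CR : dd (e 0) P u0 = dd (e 1) Q u0 ->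
  dd (e 1) P u0 = - dd (e 0) Q u0 -> derivable (F : R[i]^o -> R[i]^o) w0 1.
Proof.
move=> CR1 CR2; apply/cvg_ex; exists (Complex (dd (e 0) P u0) (dd (e 0) Q u0) : R[i]^o).
apply/cvgrPdist_le => /= eps eps0.
have [k k0 ->] : exists2 k : R, 0 < k & eps = k%:C%C.
  move: eps0; rewrite ltcE => /andP[/eqP Ie Re0]; exists (complex.Re eps) => //.
  by case: eps Ie Re0 => a b /= ->.
have k2 : 0 < k / 2 by rewrite divr_gt0.
have [r1 r10 H1] := linear_approximation dP k2.
have [r2 r20 H2] := linear_approximation dQ k2.
have [r3 r30 H3] := near_FPQ.
(* Both expansions and the identity of F with P + i Q are valid on this ball. *)
pose r := Num.min r1 (Num.min r2 r3).
have r0 : 0 < r by rewrite !lt_min r10 r20.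
apply/nbhs_ballP; exists r%:C%C; first by rewrite /= ltcR.
move=> h; rewrite /ball /= sub0r normrN normcE ltcR !lt_min => /and3P[hr1 hr2 hr3] h0.
rewrite /GRing.scale /= mulr1 H3//.
have vr s : cnorm h < s -> `|zrow h| < s by exact: le_lt_trans (zrow_norm_le h).
have := H1 _ (vr _ hr1); have := H2 _ (vr _ hr2).
rewrite (complex_differential (zrow h) dP) (complex_differential (zrow h) dQ) CR2 -CR1.
set a := P _ - _; set b := Q _ - _.
move: (dd (e 0) P u0) (dd (e 0) Q u0) => p q Hb Ha.
have N0 := cnorm_gt0 h0.
rewrite normcE lecR -(ler_pM2l N0) -cnormM mulrBr mulrA mulfV// mul1r.
have -> : h * Complex p q - Complex a b =
    - Complex (a - (zrow h 0 0 * p + zrow h 0 1 * - q)) (b - (zrow h 0 0 * q + zrow h 0 1 * p)).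
  rewrite !mxE /=; case: (h : R[i]) => x y.
  by apply/eqP; rewrite eq_complex /=; apply/andP; split; apply/eqP; ring.
rewrite cnormN; apply: le_trans (cnorm_le _ _) _; apply: le_trans (lerD Ha Hb) _.
by have := ler_wpM2l (ltW k0) (zrow_norm_le h); lra.
Qed.

(** Restricting the complex limit to the real line through a direction c gives the
directional derivatives of the real and imaginary parts along c. *)
Lemma derive_of_complex_derivable : derivable (F : R[i]^o -> R[i]^o) w0 1 ->
  exists l : R[i], forall c, c != 0 ->
    dd (zrow c) P u0 = complex.Re (c * l) /\ dd (zrow c) Q u0 = complex.Im (c * l).
Proof.
move=> /cvg_ex[/= l /cvgrPdist_le /= lF]; exists l => c c0.
have N0 := cnorm_gt0 c0.
have [r3 r30 H3] := near_FPQ.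
have key (k : R) : 0 < k -> \forall t \near (0 : R)^', 
    cnorm (c * l - Complex (t^-1 * (P (t *: zrow c + u0) - P u0))
                           (t^-1 * (Q (t *: zrow c + u0) - Q u0))) <= k.
  move=> k0; have kN : 0 < k / cnorm c by rewrite divr_gt0.
  have /nbhs_ballP[r /= r0 rl] := lF (k / cnorm c)%:C%C (etrans (ltcR _ _) kN).
  have [s s0 rs] : exists2 s : R, 0 < s & r = s%:C%C.
    move: r0; rewrite ltcE => /andP[/eqP Ie Re0]; exists (complex.Re r) => //.
    by case: r Ie Re0 {rl} => a b /= ->.
  apply/nbhs_ballP; exists (Num.min s r3 / cnorm c).
    by rewrite /= divr_gt0// lt_min s0.
  move=> t; rewrite /ball /= sub0r normrN ltr_pdivlMr// lt_min => /andP[ts tr3] t0.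
  have tc0 : t%:C%C * c != 0.
    by rewrite mulf_neq0//; apply: contra_neq t0 => /complexI.
  have := rl (t%:C%C * c); rewrite -ball_normE /= sub0r normrN normcE rs ltcR.
  rewrite cnormM cnorm_real => /(_ ts tc0).
  rewrite /GRing.scale /= mulr1 H3 ?cnormM ?cnorm_real// zrowZ normcE lecR.
  rewrite ler_pdivlMr// mulrC -cnormM mulrBr; congr (cnorm (_ - _) <= _).
  rewrite invfM [_ * c^-1]mulrC mulrA mulrA mulfV// mul1r.
  rewrite -[t%:C%C^-1]fmorphV /=.
  by apply/eqP; rewrite eq_complex /= !mul0r subr0 addr0 !eqxx.
split.
- rewrite ddE; apply/cvg_lim => //; apply/cvgrPdist_le => /= k k0.
  apply: filterS (key k k0) => t; apply: le_trans.
  rewrite (le_trans _ (Re_le_cnorm _))//; case: (c * l) => x y /=.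
  done.
- rewrite ddE; apply/cvg_lim => //; apply/cvgrPdist_le => /= k k0.
  apply: filterS (key k k0) => t; apply: le_trans.
  rewrite (le_trans _ (Im_le_cnorm _))//; case: (c * l) => x y /=.
  done.
Qed.

Lemma zrow1 : zrow 1 = e 0.
Proof. by apply/rowP => i; rewrite !mxE eqxx; case: (i == 0). Qed.

Lemma zrowi : zrow 'i%C = e 1.
Proof. by apply/rowP => i; rewrite !mxE eqxx; case: i => -[|[|]]. Qed.

(** The directions 1 and i give the Cauchy-Riemann equations. *)
Lemma complex_derivableP : derivable (F : R[i]^o -> R[i]^o) w0 1 <->
  dd (e 0) P u0 = dd (e 1) Q u0 /\ dd (e 1) P u0 = - dd (e 0) Q u0.
Proof.
split=> [/derive_of_complex_derivable[l H]|[]]; last exact: complex_derivable_of_CR.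
have i0 : 'i%C != 0 :> R[i] by rewrite eq_complex /= oner_eq0 andbF.
have [] := H 1 (oner_neq0 _); have [] := H _ i0.
rewrite zrow1 zrowi => -> -> -> ->.
by case: l {H} => x y /=; rewrite !mul0r !mul1r sub0r add0r subr0 addr0.
Qed.
End CauchyRiemann.

(** * Charts of manifolds and invariance of the second fundamental form *)

Section ChartTopology.
Context {R : realType} {n : nat} {T : topologicalType}.
Implicit Types c d : chart R n T.

Lemma chart_continuous c p : is_chart c -> cdom c p -> {for p, continuous c}.
Proof.
move=> [oc _ _ + _] cp; rewrite continuous_open_subspace//.
by apply; exact: mem_set.
Qed.

Lemma chart_nbhs c p (S : set 'rV[R]_n) : is_chart c -> cdom c p ->
  nbhs (c p) S -> nbhs p (c @^-1` S).
Proof. by move=> ch cp; exact: chart_continuous. Qed.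

(** The image is the preimage of an open set under the inverse of the chart, which
is continuous on the open image of the chart. *)
Lemma chart_open_image c (O : set T) : is_chart c -> open O ->
  open (c @` (cdom c `&` O)).
Proof.
move=> [_ oi cK _ +] oO; rewrite continuous_open_subspace// => ci.
rewrite openE => _ [p [cp Op] <-]; rewrite /interior.
have cimp : cim c (c p) by exists p.
have := ci _ (mem_set cimp).
rewrite /continuous_at cK// => /(_ O (open_nbhs_nbhs (conj oO Op))) nO.
have : nbhs (c p) (cim c) by exact: open_nbhs_nbhs.
have {}nO : nbhs (c p) (cinv c @^-1` O) := nO.
apply: filterS2 nO => u Ou [q cq cqu]; exists q => //; split=> //.
by rewrite -(cK q cq) cqu.
Qed.
End ChartTopology.

Lemma chart_metric {R : realType} {n : nat} (M : smooth_manifold R n)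
    (g : riemannian_metric M) c : atlas c -> local_metric (cim c) (g c).
Proof.
move=> ac; have [_ oc _ _ _] := atlas_chart ac; split=> //.
- exact: metric_smooth.
- by move=> y; exact: metric_sym.
- by move=> y X cy X0; rewrite inner.unlock; exact: metric_posdef.
Qed.

Lemma isometric_jacobian {R : realType} {m n : nat} (U : set 'rV[R]_m)
    (G : 'rV[R]_m -> 'M[R]_m) (K : 'rV[R]_n -> 'M[R]_n) (f : 'rV[R]_m -> 'rV[R]_n) :
  smooth_on U f ->
  (forall u, U u -> jacobian f u *m K (f u) *m (jacobian f u)^T = G u) ->
  @isometric _ _ _ U G K f.
Proof.
move=> sf H u v w Uu; have df := smooth_on_differentiable sf Uu.
by rewrite !ddE !deriveEjacobian//; exact: inner_mulmx (H u Uu).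
Qed.

Section Transition.
Context {R : realType} {n : nat} {M : smooth_manifold R n} (g : riemannian_metric M).
Variables (c d : chart R n M).
Hypotheses (ac : atlas c) (ad : atlas d).

Definition overlap : set 'rV[R]_n := c @` (cdom c `&` cdom d).

Lemma overlap_open : open overlap.
Proof.
by apply: chart_open_image; [exact: atlas_chart|have [] := atlas_chart ad].
Qed.

Lemma overlap_metric : local_metric overlap (g c).
Proof.
apply: local_metric_sub overlap_open _ (chart_metric g ac).
by move=> _ [p [cp dp] <-]; exists p.
Qed.

Lemma transition_at p : cdom c p -> transition c d (c p) = d p.
Proof. by move=> cp; rewrite /transition; have [_ _ ->] := atlas_chart ac. Qed.

Lemma transition_smooth : smooth_on overlap (transition c d).
Proof. by have [] := atlas_compatible ac ad. Qed.

Lemma transition_into u : overlap u -> cim d (transition c d u).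
Proof. by move=> [p [cp dp] <-]; rewrite transition_at//; exists p. Qed.

(** This is the transformation law of the components of the metric. *)
Lemma transition_isometric : @isometric _ _ _ overlap (g c) (g d) (transition c d).
Proof.
apply: isometric_jacobian => [|_ [p [cp dp] <-]]; first exact: transition_smooth.
by rewrite transition_at// [RHS](metric_tensor g ac ad cp dp).
Qed.

Lemma transition_metric p : cdom c p -> cdom d p ->
  dmat (transition c d) (c p) *m g d (d p) *m (dmat (transition c d) (c p))^T = g c (c p).
Proof.
move=> cp dp; have ov : overlap (c p) by exists p.
apply/matrixP => i j; rewrite -[RHS]inner_delta -(transition_isometric _ _ ov).
rewrite !(dd_dmat transition_smooth)// transition_at//.
by set J := dmat _ _; rewrite (inner_mulmx (A := J *m g d (d p) *m J^T))// inner_delta.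
Qed.
End Transition.

Section ImmersionInCharts.
Context {R : realType} {m n : nat}.
Context {M : smooth_manifold R m} {N : smooth_manifold R n}.
Context {g : riemannian_metric M} {h : riemannian_metric N} {phi : M -> N}.
Hypothesis imm : riemannian_immersion g h phi.
Local Notation e := (delta_mx 0).

Lemma phi_open_preimage (O : set N) : open O -> open (phi @^-1` O).
Proof.
by move=> oO; have [[/continuousP + _] _] := imm; apply.
Qed.

Section TwoCharts.
Variables (c : chart R m M) (d : chart R n N).
Hypotheses (ac : atlas c) (ad : atlas d).

Definition rep_dom : set 'rV[R]_m := c @` (cdom c `&` phi @^-1` cdom d).

Lemma rep_dom_open : open rep_dom.
Proof.
apply: chart_open_image; first exact: atlas_chart.
by apply: phi_open_preimage; have [] := atlas_chart ad.
Qed.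

Lemma rep_metric : local_metric rep_dom (g c).
Proof.
apply: local_metric_sub rep_dom_open _ (chart_metric g ac).
by move=> _ [p [cp dp] <-]; exists p.
Qed.

Lemma local_rep_at p : cdom c p -> local_rep phi c d (c p) = d (phi p).
Proof. by move=> cp; rewrite /local_rep; have [_ _ ->] := atlas_chart ac. Qed.

Lemma rep_smooth : smooth_on rep_dom (local_rep phi c d).
Proof. by have [[_ +] _] := imm; apply. Qed.

Lemma rep_into u : rep_dom u -> cim d (local_rep phi c d u).
Proof. by move=> [p [cp dp] <-]; rewrite local_rep_at//; exists (phi p). Qed.

Lemma rep_isometric : @isometric _ _ _ rep_dom (g c) (h d) (local_rep phi c d).
Proof.
apply: isometric_jacobian => [|_ [p [cp dp] <-]]; first exact: rep_smooth.
by rewrite local_rep_at//; have [_ /(_ c d p ac ad cp dp)[]] := imm.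
Qed.
End TwoCharts.

Section TargetChange.
Variables (c : chart R m M) (d d' : chart R n N) (p : M).
Hypotheses (ac : atlas c) (ad : atlas d) (ad' : atlas d').
Hypotheses (cp : cdom c p) (dp : cdom d (phi p)) (dp' : cdom d' (phi p)).

Definition target_jac := dmat (transition d d') (d (phi p)).

(** The new representation is the composite of the old one with a transition map
of the target, whose second fundamental form vanishes. *)
Lemma second_ff_target i j :
  second_ff (g c) (h d') (local_rep phi c d') (c p) i j =
  second_ff (g c) (h d) (local_rep phi c d) (c p) i j *m target_jac.
Proof.
pose U := c @` (cdom c `&` phi @^-1` (cdom d `&` cdom d')).
have [[od _ dK _ _] [od' _ _ _ _]] := (atlas_chart ad, atlas_chart ad').
have oU : open U.
  apply: chart_open_image; first exact: atlas_chart.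
  by apply: phi_open_preimage; exact: openI.
have Up : U (c p) by exists p.
have Ud : U `<=` rep_dom c d by move=> _ [q [cq [dq dq']] <-]; exists q.
have Ud' : U `<=` rep_dom c d' by move=> _ [q [cq [dq dq']] <-]; exists q.
have sf := smooth_on_subset Ud (rep_smooth ac ad).
have sf' := smooth_on_subset Ud' (rep_smooth ac ad').
have fU u : U u -> overlap d d' (local_rep phi c d u).
  by move=> [q [cq [dq dq']] <-]; rewrite local_rep_at//; exists (phi q).
have Eq u : U u -> local_rep phi c d' u = transition d d' (local_rep phi c d u).
  move=> [q [cq [dq dq']] <-].
  by rewrite !local_rep_at// transition_at.
rewrite (second_ffE sf' _ _ Up) (second_ffE sf _ _ Up).
rewrite (sff_ext _ _ _ _ oU Eq Up).
have sT := transition_smooth ad ad'.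
rewrite (sff_comp (K := h d) oU (overlap_open ad ad') sf fU sT)//.
rewrite (isometry_sff0 (overlap_metric h ad ad') (chart_metric h ad') sT
  (transition_into ad) (transition_isometric h ad ad')); last exact: fU.
by rewrite addr0 (dd_dmat sT); [rewrite local_rep_at|exact: fU].
Qed.
End TargetChange.

Section SourceChange.
Variables (c c' : chart R m M) (d : chart R n N) (p : M).
Hypotheses (ac : atlas c) (ac' : atlas c') (ad : atlas d).
Hypotheses (cp : cdom c p) (cp' : cdom c' p) (dp : cdom d (phi p)).

(** The new representation is the composite of a transition map of the source with
the old one. The transition map contributes nothing but its differential, whose
rows are the coordinate vectors of the new chart. *)
Lemma second_ff_source i j :
  let J := dmat (transition c' c) (c' p) in
  second_ff (g c') (h d) (local_rep phi c' d) (c' p) i j =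
  sff (g c) (h d) (local_rep phi c d) (row i J) (row j J) (c p).
Proof.
move=> J; pose U := c' @` (cdom c' `&` (cdom c `&` phi @^-1` cdom d)).
have [[od _ dK _ _] [oc _ cK _ _]] := (atlas_chart ad, atlas_chart ac).
have oU : open U.
  apply: chart_open_image; first exact: atlas_chart.
  by apply: openI => //; exact: phi_open_preimage.
have Up : U (c' p) by exists p.
have Uo : U `<=` overlap c' c by move=> _ [q [cq [dq dq']] <-]; exists q.
have Ud : U `<=` rep_dom c' d by move=> _ [q [cq [dq dq']] <-]; exists q.
have sT := smooth_on_subset Uo (transition_smooth ac' ac).
have sf' := smooth_on_subset Ud (rep_smooth ac' ad).
have fU u : U u -> rep_dom c d (transition c' c u).
  by move=> [q [cq [dq dq']] <-]; rewrite transition_at//; exists q.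
have Eq u : U u -> local_rep phi c' d u = local_rep phi c d (transition c' c u).
  by move=> [q [cq [dq dq']] <-]; rewrite transition_at// !local_rep_at.
have Vp : rep_dom c d (c p) by exists p.
have lG := overlap_metric g ac' ac.
rewrite (second_ffE sf' _ _ Up) (sff_ext _ _ _ _ oU Eq Up).
rewrite (sff_comp (K := g c) oU (rep_dom_open ac ad) sT fU (rep_smooth ac ad))//.
rewrite (isometry_sff0 lG (chart_metric g ac) (transition_smooth ac' ac)
  (transition_into ac') (transition_isometric g ac' ac)); last exact: Uo.
rewrite ddE derive0 add0r transition_at//.
by rewrite !(dd_dmat (transition_smooth ac' ac)) -?rowE//; exact: Uo.
Qed.

Lemma metric_trace_source :
  metric_trace (g c') (c' p) (second_ff (g c') (h d) (local_rep phi c' d) (c' p)) =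
  metric_trace (g c) (c p) (second_ff (g c) (h d) (local_rep phi c d) (c p)).
Proof.
have Vp : rep_dom c d (c p) by exists p.
have ov : overlap c' c (c' p) by exists p.
have lK := chart_metric h ad.
have sf := rep_smooth ac ad; have lG := rep_metric ac ad.
have into := rep_into (d := d) ac.
(* The trace of this bilinear map is computed in two bases that are related
   by the Jacobian of the transition map. *)
pose S X Y := sff (g c) (h d) (local_rep phi c d) X Y (c p).
pose J := dmat (transition c' c) (c' p).
transitivity (metric_trace (g c') (c' p) (fun i j => S (row i J) (row j J))).
  by apply: eq_bigr => i _; apply: eq_bigr => j _; rewrite second_ff_source.
have SDl X Y Z : S (X + Y) Z = S X Z + S Y Z by exact: (sffDl sf X Y Z Vp).
have SZl a X Z : S (a *: X) Z = a *: S X Z by exact: (sffZl sf a X Z Vp).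
have SC X Y : S X Y = S Y X by exact: (sffC lG lK sf into X Y Vp).
rewrite (metric_trace_change SDl SZl SC (transition_metric g ac' ac cp' cp)).
- by apply: eq_bigr => i _; apply: eq_bigr => j _; rewrite (second_ffE sf).
- exact: (lm_unit lG).
- by apply: (lm_unit (chart_metric g ac')); exists p.
Qed.
End SourceChange.

End ImmersionInCharts.

(** * Biharmonic surfaces *)

Lemma metric_trace_mulmx {R : realType} {m n p : nat} (G : 'rV[R]_m -> 'M[R]_m) u
    (T : 'I_m -> 'I_m -> 'rV[R]_n) (J : 'M[R]_(n, p)) :
  metric_trace G u (fun i j => T i j *m J) = metric_trace G u T *m J.
Proof.
rewrite /metric_trace mulmx_suml; apply: eq_bigr => i _.
by rewrite mulmx_suml; apply: eq_bigr => j _; rewrite -scalemxAl.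
Qed.

Lemma innerC_map {R : realType} {n : nat} (K : 'M[R]_n) (X Y : 'rV[R]_n) :
  innerC K (map_mx (real_complex R) X) (map_mx (real_complex R) Y) = (inner K X Y)%:C%C.
Proof.
by rewrite /innerC map_trmx -!map_mxM mxE inner.unlock.
Qed.

(** d/dz = (d/dx - i d/dy) / 2 gives
4 B(d/dz, d/dz) = B_00 - B_11 - 2 i B_01. *)
Lemma innerC_partial_z {R : realType} {n : nat} (K : 'M[R]_n)
    (B : 'I_2 -> 'I_2 -> 'rV[R]_n) (H : 'rV[R]_n) : B 0 1 = B 1 0 ->
  innerC K (bilinC B (partial_z (R := R)) (partial_z (R := R)))
    (map_mx (real_complex R) H) =
  Complex ((inner K (B 0 0) H - inner K (B 1 1) H) / 4)
          (- (inner K (B 0 1) H / 2)).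
Proof.
have half : 2^-1 = Complex 2^-1 0 :> R[i].
  by rewrite -[RHS]/((2^-1)%:C%C) fmorphV rmorph_nat.
have p0 : partial_z (R := R) 0 0 = Complex 2^-1 0.
  by rewrite !mxE /= mulr0 subr0 mulr1 half.
have p1 : partial_z (R := R) 0 1 = Complex 0 (- 2^-1).
  rewrite !mxE /= sub0r mulr1 half.
  by apply/eqP; rewrite eq_complex /=; apply/andP; split; apply/eqP; ring.
have iD V W (X : 'rV[R[i]]_n) : innerC K (V + W) X = innerC K V X + innerC K W X.
  by rewrite /innerC !mulmxDl !mxE.
have iZ a V (X : 'rV[R[i]]_n) : innerC K (a *: V) X = a * innerC K V X.
  by rewrite /innerC -!scalemxAl !mxE.
move=> BC; rewrite /bilinC !sum_ord2 p0 p1 -BC !iD !iZ !innerC_map.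
apply/eqP; rewrite eq_complex /=; apply/andP; split; apply/eqP.
  by move: (inner K (B 0 0) H) (inner K (B 0 1) H) (inner K (B 1 1) H) => x y t; field.
by move: (inner K (B 0 0) H) (inner K (B 0 1) H) (inner K (B 1 1) H) => x y t; field.
Qed.

(** The letters a, b and c stand for the first derivatives of A_00, A_11 and A_01,
and q for those of |W|^2; x is the conformal factor. The left-hand side of the
equivalence is the pair of Cauchy-Riemann equations for
(A_00 - A_11) / 8 - i A_01 / 4. *)
Lemma CR_stress {R : realFieldType} (a0 a1 b0 b1 c0 c1 x q0 q1 : R) : 0 < x ->
  2 * (a0 + c1) = a0 + b0 - x / 2 * q0 ->
  2 * (c0 + b1) = a1 + b1 - x / 2 * q1 ->
  ((a0 - b0) / 8 = - (c1 / 4) /\ (a1 - b1) / 8 = - - (c0 / 4)) <->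
  (q0 = 0 /\ q1 = 0).
Proof.
move=> x0 E0 E1.
have cancel q : x / 2 * q = 0 -> q = 0.
  by move=> /eqP; rewrite mulf_eq0 gt_eqF ?divr_gt0//= => /eqP.
split=> [[C0 C1]|[Q0 Q1]].
  by split; apply: cancel; lra.
by move: E0 E1; rewrite Q0 Q1 mulr0 => E0 E1; split; lra.
Qed.

Section BiharmonicSurface.
Context {R : realType} {n : nat}.
Context {M : smooth_manifold R 2} {N : smooth_manifold R n}.
Context {g : riemannian_metric M} {o : orientation M}.
Context {h : riemannian_metric N} {phi : M -> N}.
Hypothesis imm : riemannian_immersion g h phi.
Local Notation e := (delta_mx 0).
Local Notation MC := (mean_curvature g h phi).

Lemma mean_curvature_target c d d' p : atlas c -> atlas d -> atlas d' ->
  cdom c p -> cdom d (phi p) -> cdom d' (phi p) ->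
  MC c d' p = MC c d p *m dmat (transition d d') (d (phi p)).
Proof.
move=> ac ad ad' cp dp dp'; rewrite /mean_curvature -scalemxAl -metric_trace_mulmx.
congr (_ *: _); apply: eq_bigr => i _; apply: eq_bigr => j _.
by rewrite (second_ff_target imm ac ad ad' cp dp dp').
Qed.

(** The charts in the definition of the norm are replaced one after the other: the
target chart first, by the tensor law, and then the source chart. *)
Lemma norm_HE c d p : atlas c -> atlas d -> cdom c p -> cdom d (phi p) ->
  norm_H g h phi p = Num.sqrt (inner (h d (d (phi p))) (MC c d p) (MC c d p)).
Proof.
move=> ac ad cp dp; rewrite /norm_H /chart_at.
case: cid => c' [ac' cp'] /=; case: cid => d' [ad' dp'] /=.
rewrite -[X in Num.sqrt X](_ :
    inner (h d' (d' (phi p))) (MC c' d' p) (MC c' d' p) = _); last first.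
  by rewrite inner.unlock.
rewrite (mean_curvature_target ac' ad ad' cp' dp dp').
rewrite (inner_mulmx _ _ (transition_metric h ad ad' dp dp')).
by rewrite /mean_curvature (metric_trace_source imm ac ac' ad cp cp' dp).
Qed.

Lemma BzzHE z d p : atlas z -> atlas d -> cdom z p -> cdom d (phi p) ->
  let II := second_ff (g z) (h d) (local_rep phi z d) (z p) in
  let a i j := inner (h d (d (phi p))) (II i j) (MC z d p) in
  BzzH g h phi z p = Complex ((a 0 0 - a 1 1) / 4) (- (a 0 1 / 2)).
Proof.
move=> az ad zp dp II a; rewrite /BzzH /chart_at.
case: cid => d' [ad' dp'] /=.
have E i j : inner (h d' (d' (phi p)))
    (second_ff (g z) (h d') (local_rep phi z d') (z p) i j) (MC z d' p) = a i j.
  rewrite (mean_curvature_target az ad ad' zp dp dp').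
  rewrite (second_ff_target imm az ad ad' zp dp dp').
  exact: inner_mulmx _ _ (transition_metric h ad ad' dp dp').
rewrite innerC_partial_z ?E//.
have U : rep_dom (phi := phi) z d' (z p) by exists p.
rewrite !(second_ffE (rep_smooth imm az ad'))//.
exact: (sffC (rep_metric imm az ad') (chart_metric h ad')
  (rep_smooth imm az ad') (rep_into az)).
Qed.

Section LocalAnalysis.
Hypothesis bih : biharmonic g h phi.
Variables (z : chart R 2 M) (d : chart R n N).
Hypotheses (cz : complex_coordinate g o z) (ad : atlas d).
Let az : atlas z. Proof. by have [/positive_atlas] := cz. Qed.
Let U := rep_dom (phi := phi) z d.
Let G := g z.
Let K := h d.
Let f := local_rep phi z d.
Let W := tension G K f.
Let oU : open U := rep_dom_open imm az ad.
Let lG : local_metric U G := rep_metric imm az ad.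
Let lK : local_metric (cim d) K := chart_metric h ad.
Let sf : smooth_on U f := rep_smooth imm az ad.
Let fU : forall u, U u -> cim d (f u) := rep_into az.
Let iso : @isometric _ _ _ U G K f := rep_isometric imm az ad.

Let conf u : U u -> G u = (G u 0 0)%:M.
Proof.
move=> [p [zp dp] <-]; have [_ /(_ (z p))[|l [l0 E]]] := cz; first by exists p.
by rewrite /G E mxE eqxx mulr1n.
Qed.

Let sW : smooth_on U W := smooth_tension lG lK sf fU conf.
Let Wn u x : U u -> inner (K (f u)) (W u) (dd x f u) = 0.
Proof. exact: tension_normal lG lK sf fU iso conf u x. Qed.

(** |W|^2 = 4 |H|^2 as a function of the coordinates; the square is smooth, and
the norm need not be. *)
Definition tension_sq u := inner (h d (local_rep phi z d u))
  (tension (g z) (h d) (local_rep phi z d) u) (tension (g z) (h d) (local_rep phi z d) u).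
Let A i j := @shape R 2 n K f W (e i) (e j).

Let sA i j : smooth_on U (A i j).
Proof. exact: (smooth_shape oU lK sf fU sW (e i) (e j)). Qed.

Lemma smooth_tension_sq : smooth_on U tension_sq.
Proof.
apply: smooth_inner => //.
exact: smooth_comp oU (lm_open lK) (lm_smooth lK) sf fU.
Qed.

Lemma tension_sq_norm_H p : cdom z p -> cdom d (phi p) ->
  tension_sq (z p) = 4 * norm_H g h phi p ^+ 2.
Proof.
move=> zp dp; rewrite (norm_HE az ad zp dp).
have pos X : 0 <= inner (K (d (phi p))) X X.
  have [->|X0] := eqVneq X 0; first by rewrite inner0l.
  by apply/ltW/(lm_pos lK) => //; exists (phi p).
rewrite sqr_sqrtr// /mean_curvature innerZl innerZr.
rewrite /tension_sq /tension local_rep_at//.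
by inner_atoms; field.
Qed.

Let BzzH_shape p : cdom z p -> cdom d (phi p) ->
  BzzH g h phi z p = Complex ((A 0 0 (z p) - A 1 1 (z p)) / 8) (- (A 0 1 (z p) / 4)).
Proof.
move=> zp dp; rewrite (BzzHE az ad zp dp).
have Up : U (z p) by exists p.
have E i j : inner (K (d (phi p))) (second_ff G K f (z p) i j) (MC z d p) = A i j (z p) / 2.
  rewrite -(local_rep_at (phi := phi) d az zp) /mean_curvature innerZr (second_ffE sf)//.
  rewrite (inner_sym _ _ (lm_sym lK (fU Up))) sff.unlock innerDr innerNr.
  by rewrite -[metric_trace _ _ _]/(W (z p)) Wn// subr0 mulrC.
rewrite !E; congr Complex.
  by move: (A 0 0 (z p)) (A 1 1 (z p)) => x y; field.
by move: (A 0 1 (z p)) => x; field.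
Qed.

(** The two components of the conservation law [conformal_stress_divergence]
against the two Cauchy-Riemann equations. *)
Lemma derivable_BzzH p : cdom z p -> cdom d (phi p) ->
  derivable ((fun w => BzzH g h phi z (zinv z w)) : R[i]^o -> R[i]^o) (zfun z p) 1 <->
  dd (e 0) tension_sq (z p) = 0 /\ dd (e 1) tension_sq (z p) = 0.
Proof.
move=> zp dp; have Up : U (z p) by exists p.
pose P u := (A 0 0 u - A 1 1 u) / 8; pose Q u := - (A 0 1 u / 4).
have zK : zrow (zfun z p) = z p.
  apply/rowP => i; rewrite mxE /=.
  by case: i => -[|[|//]] i2 /=; congr (z p _ _); apply/val_inj.
have dA i j : differentiable (A i j) (z p) by exact: smooth_on_differentiable (sA i j) Up.
have dP : differentiable P (z p).
  by apply: differentiableM; [exact: differentiableB|exact: differentiable_cst].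
have dQ : differentiable Q (z p).
  apply: differentiableN; apply: differentiableM => //; exact: differentiable_cst.
have DP v : dd v P (z p) = (dd v (A 0 0) (z p) - dd v (A 1 1) (z p)) / 8.
  rewrite -ddB// [RHS]mulrC -[RHS]/(_ *: _) -ddZ; last exact: differentiableB.
  by congr (dd _ _ _); apply/funext => u; rewrite /P mulrC.
have DQ v : dd v Q (z p) = - (dd v (A 0 1) (z p) / 4).
  transitivity (dd v (fun u => (- 4^-1) *: A 0 1 u) (z p)).
    by congr (dd _ _ _); apply/funext => u; rewrite /Q [RHS]mulNr mulrC.
  by rewrite ddZ// [LHS]mulNr mulrC.
have FPQ : \forall u \near zrow (zfun z p),
    BzzH g h phi z (zinv z (Complex ((u : 'rV[R]_2) 0 0) (u 0 1))) = Complex (P u) (Q u).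
  rewrite zK; apply: filterS (nbhsU oU Up) => _ [p' [zp' dp'] <-].
  rewrite -(BzzH_shape zp' dp'); congr BzzH.
  have [_ _ zinvK _ _] := atlas_chart az; rewrite -[RHS](zinvK p' zp').
  rewrite /zinv; congr (cinv z _); apply/rowP => i; rewrite mxE /=.
  by case: i => -[|[|//]] i2 /=; congr (z p' _ _); apply/val_inj.
rewrite -zK in dP dQ.
rewrite (complex_derivableP dP dQ FPQ) zK !DP !DQ.
have bit : bitension G K f (z p) = 0 by exact: bih.
have gt0 := conformal_factor_gt0 lG Up.
have AC v : dd v (A 1 0) (z p) = dd v (A 0 1) (z p).
  apply: dd_near; apply: filterS (nbhsU oU Up) => u Uu.
  exact: (shapeC oU lK sf fU _ _ Uu).
have E0 : 2 * (dd (e 0) (A 0 0) (z p) + dd (e 1) (A 0 1) (z p)) =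
    dd (e 0) (A 0 0) (z p) + dd (e 0) (A 1 1) (z p)
    - G (z p) 0 0 / 2 * dd (e 0) tension_sq (z p).
  rewrite -AC -ddD//.
  exact: (conformal_stress_divergence lG lK sf fU iso conf (e 0) Up bit).
have E1 : 2 * (dd (e 0) (A 0 1) (z p) + dd (e 1) (A 1 1) (z p)) =
    dd (e 1) (A 0 0) (z p) + dd (e 1) (A 1 1) (z p)
    - G (z p) 0 0 / 2 * dd (e 1) tension_sq (z p).
  rewrite -ddD//.
  exact: (conformal_stress_divergence lG lK sf fU iso conf (e 1) Up bit).
exact: CR_stress gt0 E0 E1.
Qed.

Lemma norm_H_locally_constant p : cdom z p -> cdom d (phi p) ->
  holomorphic_in z (BzzH g h phi z) ->
  \forall p' \near p, norm_H g h phi p' = norm_H g h phi p.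
Proof.
move=> zp dp hol; have Up : U (z p) by exists p.
have dq0 u i : U u -> dd (e i) tension_sq u = 0.
  move=> [p' [zp' dp'] <-]; have [H0 H1] := (derivable_BzzH zp' dp').1 (hol p' zp').
  by case: i => -[|[|//]] i2; [rewrite -[RHS]H0|rewrite -[RHS]H1];
    congr (dd (e _) _ _); apply/val_inj.
pose S : set 'rV[R]_2 := fun u => tension_sq u = tension_sq (z p).
have nS : nbhs (z p) S.
  apply: (@locally_constant_of_zero_derivative R 2 U tension_sq) => //.
  by move=> u; exact: smooth_on_differentiable smooth_tension_sq.
have chz := atlas_chart az; have [oz _ _ _ _] := chz.
have [od _ _ _ _] := atlas_chart ad.
have near_q : nbhs p (z @^-1` S) := chart_nbhs chz zp nS.
have near_z : nbhs p (cdom z) by exact: open_nbhs_nbhs.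
have near_d : nbhs p (phi @^-1` cdom d).
  by apply: open_nbhs_nbhs; split=> //; exact: phi_open_preimage imm _ od.
apply: filterS3 near_q near_z near_d => p' + zp' dp'.
rewrite /S /preimage /= (tension_sq_norm_H zp' dp') (tension_sq_norm_H zp dp).
have n0 x : 0 <= norm_H g h phi x by rewrite /norm_H sqrtr_ge0.
move: (norm_H g h phi p') (norm_H g h phi p) (n0 p') (n0 p) => x y x0 y0 xy.
by apply/eqP; rewrite -(eqrXn2 (n := 2))//; apply/eqP; lra.
Qed.

Lemma derivable_of_norm_H_locally_constant p : cdom z p -> cdom d (phi p) ->
  (\forall p' \near p, norm_H g h phi p' = norm_H g h phi p) ->
  derivable ((fun w => BzzH g h phi z (zinv z w)) : R[i]^o -> R[i]^o) (zfun z p) 1.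
Proof.
move=> zp dp lc; have Up : U (z p) by exists p.
apply/(derivable_BzzH zp dp).
have near_q : \forall u \near z p, tension_sq u = tension_sq (z p).
  have : nbhs p (fun p' => norm_H g h phi p' = norm_H g h phi p) by exact: lc.
  rewrite nbhsE => -[ S [oS Sp] Ssub].
  have oV : open (z @` (cdom z `&` (S `&` phi @^-1` cdom d))).
    apply: chart_open_image; first exact: atlas_chart.
    apply: openI => //; apply: phi_open_preimage imm _ _.
    by have [] := atlas_chart ad.
  have Vp : (z @` (cdom z `&` (S `&` phi @^-1` cdom d))) (z p) by exists p.
  apply: filterS (nbhsU oV Vp) => _ [p' [zp' [Sp' dp']] <-].
  by rewrite (tension_sq_norm_H zp' dp') (tension_sq_norm_H zp dp) (Ssub p' Sp').
by split; rewrite (dd_near _ near_q) dd_cst.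
Qed.
End LocalAnalysis.
End BiharmonicSurface.

Unset Implicit Arguments.
Theorem theorem3 (R : realType) (n : nat)
    (M : smooth_manifold R 2) (g : riemannian_metric M) (o : orientation M)
    (N : smooth_manifold R n) (h : riemannian_metric N)
    (phi : M -> N)
    (phi_immersion : riemannian_immersion g h phi)
    (phi_biharmonic : proper_biharmonic g h phi) :
  (forall z : chart R 2 M,
     complex_coordinate g o z -> connected (cdom z) ->
     (holomorphic_in z (BzzH g h phi z) <->
      constant_on (cdom z) (norm_H g h phi)))
  /\
  (connected [set: M] ->
   forall Z : set (chart R 2 M),
     (forall z, Z z -> complex_coordinate g o z) ->
     \bigcup_(z in Z) cdom z = [set: M] ->
     ((forall z, Z z -> holomorphic_in z (BzzH g h phi z)) <->
      constant_on [set: M] (norm_H g h phi))).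
Proof.
have [bih _] := phi_biharmonic.
have target p : exists d : chart R n N, atlas d /\ cdom d (phi p).
  exact: atlas_cover.
have domain_open z : complex_coordinate g o z -> open (cdom z).
  by move=> [/positive_atlas/atlas_chart[]].
have loc z p : complex_coordinate g o z -> cdom z p ->
    holomorphic_in z (BzzH g h phi z) ->
    \forall q \near p, norm_H g h phi q = norm_H g h phi p.
  move=> cz zp hol; have [d [ad dp]] := target p.
  exact: (norm_H_locally_constant phi_immersion bih cz ad zp dp hol).
have hol z : complex_coordinate g o z -> constant_on (cdom z) (norm_H g h phi) ->
    holomorphic_in z (BzzH g h phi z).
  move=> cz [k kP] p zp; have [d [ad dp]] := target p.
  apply: (derivable_of_norm_H_locally_constant phi_immersion bih cz ad zp dp).
  have : nbhs p (cdom z) by apply: open_nbhs_nbhs; split=> //; exact: domain_open.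
  by apply: filterS => q zq; rewrite !kP.
have glue A : connected A -> open A ->
    (forall p, A p -> \forall q \near p, norm_H g h phi q = norm_H g h phi p) ->
    constant_on A (norm_H g h phi).
  move=> cA oA lc; have [->|/set0P[p Ap]] := eqVneq A set0; first by exists 0.
  exists (norm_H g h phi p) => q Aq.
  exact: connected_locally_constant cA oA lc q p Aq Ap.
split=> [z cz cdz|cM Z cZ coverZ]; split.
- move=> hz; apply: glue cdz (domain_open z cz) _ => p zp; exact: loc cz zp hz.
- exact: hol.
- move=> hZ; apply: glue cM openT _ => p _.
  have [z Zz zp] : (\bigcup_(z in Z) cdom z) p by rewrite coverZ.
  exact: loc (cZ z Zz) zp (hZ z Zz).
- by move=> [k kP] z Zz; apply: hol; [exact: cZ|exists k => p _; exact: kP].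
Qed.
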